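(* Let $k$ be an algebraically closed field of characteristic $0$, let $p<q$ be two prime numbers satisfying $q\not\equiv 1\pmod p$, and let $A$ be a semisimple Hopf algebra over $k$ of dimension $pq$. If the dual Hopf algebra $A^*$ is of Frobenius type, then $A$ is a group algebra.
   Context: A finite-dimensional semisimple Hopf algebra $H$ over $k$ is of Frobenius type if the dimension of every irreducible representation of $H$ divides $\dim_k H$. (Over an algebraically closed field of characteristic $0$, a finite-dimensional Hopf algebra is semisimple if and only if its dual is semisimple.) ''$A$ is a group algebra'' means that $A$ is isomorphic as a Hopf algebra to $k[G]$ for some finite group $G$, with its standard Hopf algebra structure. *)

(* Defs.v *)
From HB Require Import structures.
From mathcomp Require Import all_boot all_order all_fingroup all_algebra all_field.

Set Implicit Arguments.
Unset Strict Implicit.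
Unset Printing Implicit Defensive.

Import GRing.Theory.
Local Open Scope ring_scope.

Declare Scope tensor_scope.
Delimit Scope tensor_scope with T.

(* The tensor t : tensor V W is given by its coordinates on the pure tensors
   of vectors of [vbasis {:V}] and [vbasis {:W}].  Everything after this
   section only uses [tens], [tlift] and the universal property
   ([tliftE] and [tens_ext]). *)

Section Tensor.
Variable k : fieldType.
Implicit Types U V W : vectType k.

Definition tensor V W : Type := 'M[k]_(\dim {:V}, \dim {:W}).
HB.instance Definition _ V W :=
  Vector.copy (tensor V W) 'M[k]_(\dim {:V}, \dim {:W}).

Definition tens V W (v : V) (w : W) : tensor V W :=
  \matrix_(i, j) (coord (vbasis {:V}) i v * coord (vbasis {:W}) j w).

(* The linear map tensor V W -> U induced by a bilinear b : V -> W -> U;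
   bilinearity of b is not required by the definition, but b is bilinear in
   all the uses below. *)
Definition tlift V W U (b : V -> W -> U) (t : tensor V W) : U :=
  \sum_i \sum_j t i j *: b (vbasis {:V})`_i (vbasis {:W})`_j.

Definition bilin V W U (b : V -> W -> U) : Prop :=
  (forall v, linear (b v)) /\ (forall w, linear (b^~ w)).

Fact tlift_linear V W U (b : V -> W -> U) : linear (tlift b).
Proof.
move=> a s t; rewrite /tlift scaler_sumr -big_split; apply: eq_bigr => i _ /=.
rewrite scaler_sumr -big_split; apply: eq_bigr => j _ /=.
by rewrite !mxE scalerDl scalerA.
Qed.
HB.instance Definition _ V W U (b : V -> W -> U) :=
  GRing.isLinear.Build k (tensor V W) U _ (tlift b) (tlift_linear b).

Lemma tens_bilin V W : bilin (@tens V W).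
Proof.
split=> [v|w] a x y; apply/matrixP=> i j; rewrite !mxE linearP /=.
  by rewrite mulrDr mulrCA.
by rewrite mulrDl mulrA.
Qed.

Section Bilin.
Variables (V W U : vectType k) (b : V -> W -> U).
Hypothesis b_bil : bilin b.

Lemma bilinPr v a x y : b v (a *: x + y) = a *: b v x + b v y.
Proof. exact: b_bil.1. Qed.
Lemma bilinPl w a x y : b (a *: x + y) w = a *: b x w + b y w.
Proof. by have := b_bil.2 w a x y. Qed.
Lemma bilin0r v : b v 0 = 0.
Proof. by have := bilinPr v (-1) 0 0; rewrite scaler0 addr0 scaleN1r addNr. Qed.
Lemma bilin0l w : b 0 w = 0.
Proof. by have := bilinPl w (-1) 0 0; rewrite scaler0 addr0 scaleN1r addNr. Qed.
Lemma bilin_sumr I (r : seq I) (a : I -> k) x v :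
  b v (\sum_(i <- r) a i *: x i) = \sum_(i <- r) a i *: b v (x i).
Proof.
by elim: r => [|i r IH]; rewrite ?big_nil ?bilin0r // !big_cons bilinPr IH.
Qed.
Lemma bilin_suml I (r : seq I) (a : I -> k) x w :
  b (\sum_(i <- r) a i *: x i) w = \sum_(i <- r) a i *: b (x i) w.
Proof.
by elim: r => [|i r IH]; rewrite ?big_nil ?bilin0l // !big_cons bilinPl IH.
Qed.

Lemma tliftE v w : tlift b (tens v w) = b v w.
Proof.
rewrite {2}(coord_vbasis (memvf v)) bilin_suml; apply: eq_bigr => i _.
rewrite {2}(coord_vbasis (memvf w)) bilin_sumr scaler_sumr.
by apply: eq_bigr => j _; rewrite mxE scalerA.
Qed.
End Bilin.

Lemma tens_basis V W (i : 'I_(\dim {:V})) (j : 'I_(\dim {:W})) :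
  tens (vbasis {:V})`_i (vbasis {:W})`_j = delta_mx i j.
Proof.
apply/matrixP=> i' j'; rewrite !mxE !coord_free ?(basis_free (vbasisP _)) //.
by rewrite -natrM mulnb eq_sym [j == j']eq_sym.
Qed.

Lemma tlift_tens V W (t : tensor V W) : tlift (@tens V W) t = t.
Proof.
rewrite {2}(matrix_sum_delta t); apply: eq_bigr => i _.
by apply: eq_bigr => j _; rewrite tens_basis.
Qed.

Lemma linear_tlift V W U U' (f : {linear U -> U'}) (b : V -> W -> U) t :
  f (tlift b t) = tlift (fun v w => f (b v w)) t.
Proof.
rewrite linear_sum; apply: eq_bigr => i _.
by rewrite linear_sum; apply: eq_bigr => j _; rewrite linearZ.
Qed.

Lemma eq_tlift V W U (b c : V -> W -> U) :
  (forall v w, b v w = c v w) -> tlift b =1 tlift c.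
Proof.
by move=> bc t; apply: eq_bigr => i _; apply: eq_bigr => j _; rewrite bc.
Qed.

Lemma tlift_comb V W U a (b c : V -> W -> U) t :
  tlift (fun v w => a *: b v w + c v w) t = a *: tlift b t + tlift c t.
Proof.
rewrite /tlift scaler_sumr -big_split; apply: eq_bigr => i _ /=.
rewrite scaler_sumr -big_split; apply: eq_bigr => j _ /=.
by rewrite scalerDr !scalerA mulrC.
Qed.

Lemma tens_ext V W U (f g : tensor V W -> U) : linear f -> linear g ->
  (forall v w, f (tens v w) = g (tens v w)) -> f =1 g.
Proof.
move=> fL gL fg t.
pose F := GRing.isLinear.Build k _ _ _ f fL.
pose f' : {linear _ -> _} := HB.pack f F.
pose G := GRing.isLinear.Build k _ _ _ g gL.
pose g' : {linear _ -> _} := HB.pack g G.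
rewrite -(tlift_tens t) -[LHS]/(f' _) -[RHS]/(g' _) !linear_tlift.
exact: eq_tlift.
Qed.

Definition tmap V W V' W' (f : V -> V') (g : W -> W') :
    tensor V W -> tensor V' W' :=
  tlift (fun v w => tens (f v) (g w)).

Definition tassoc U V W : tensor (tensor U V) W -> tensor U (tensor V W) :=
  tlift (fun t w => tlift (fun u v => tens u (tens v w)) t).

End Tensor.

Notation "v ⊗ w" := (tens v w) (at level 40, left associativity) : tensor_scope.
Local Open Scope tensor_scope.

(* The multiplication of the algebra A ⊗ A: (a ⊗ b)(c ⊗ d) = ac ⊗ bd. *)
Definition tmul (k : fieldType) (A : falgType k) (s t : tensor A A) :
    tensor A A :=
  tlift (fun a b => tlift (fun c d => (a * c) ⊗ (b * d)) t) s.

Section TensorLemmas.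
Variable k : fieldType.
Implicit Types U V W : vectType k.

Lemma tliftZ V W U a (b : V -> W -> U) t :
  a *: tlift b t = tlift (fun v w => a *: b v w) t.
Proof.
rewrite /tlift scaler_sumr; apply: eq_bigr => i _.
by rewrite scaler_sumr; apply: eq_bigr => j _; rewrite !scalerA mulrC.
Qed.

Lemma linear_id_lfun V W (f : 'Hom(V, W)) : linear f.
Proof. by move=> a x y; rewrite linearP. Qed.

Lemma tmapE V W V' W' (f : V -> V') (g : W -> W') v w :
  linear f -> linear g -> tmap f g (v ⊗ w) = f v ⊗ g w.
Proof.
move=> fL gL; apply: tliftE; split=> [x|y] a s t.
  by rewrite gL (bilinPr (tens_bilin V' W')).
by rewrite fL (bilinPl (tens_bilin V' W')).
Qed.

Lemma tassoc_bilin U V W :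
  bilin (fun (t : tensor U V) (w : W) => tlift (fun u v => u ⊗ (v ⊗ w)) t).
Proof.
split=> [t|w] a x y; last by rewrite linearP.
rewrite -tlift_comb; apply: eq_tlift => u v.
by rewrite (bilinPr (tens_bilin _ _)) (bilinPr (tens_bilin _ _)).
Qed.

Lemma tassocE U V W (u : U) (v : V) (w : W) :
  tassoc ((u ⊗ v) ⊗ w) = u ⊗ (v ⊗ w).
Proof.
rewrite /tassoc (tliftE (tassoc_bilin U V W)) (@tliftE _ _ _ _ _ _ u v) //.
split=> [x|y] a s t /=.
  by rewrite (bilinPl (tens_bilin _ _)) (bilinPr (tens_bilin _ _)).
by rewrite (bilinPl (tens_bilin _ _)).
Qed.

Lemma mul_bilin (A : falgType k) : bilin (fun x y : A => x * y).
Proof.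
by split=> [v|w] a x y; rewrite ?mulrDr ?mulrDl -?scalerAr -?scalerAl.
Qed.

Lemma tmul_bilin (A : falgType k) : bilin (@tmul k A).
Proof.
split=> [s|t] a x y; last by rewrite /tmul linearP.
by rewrite /tmul -tlift_comb; apply: eq_tlift => u v; rewrite linearP.
Qed.

Lemma tmulE (A : falgType k) (a b c d : A) :
  tmul (a ⊗ b) (c ⊗ d) = (a * c) ⊗ (b * d).
Proof.
have bt := tens_bilin A A; have bm := mul_bilin A.
rewrite /tmul tliftE; last first.
  split=> [x|y] e s t; rewrite -tlift_comb; apply: eq_tlift => u v.
    by rewrite (bilinPl bm) (bilinPr bt).
  by rewrite (bilinPl bm) (bilinPl bt).
rewrite tliftE //; split=> [x|y] e s t.
  by rewrite (bilinPr bm) (bilinPr bt).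
by rewrite (bilinPr bm) (bilinPl bt).
Qed.

End TensorLemmas.

HB.mixin Record Falgebra_isHopf (k : fieldType) A of Falgebra k A := {
  comul : 'Hom(A, tensor A A);
  counit : 'Hom(A, k^o);
  antipode : 'End(A);
  comulA : forall a : A,
    tassoc (tmap comul idfun (comul a)) = tmap idfun comul (comul a);
  counitl : forall a : A,
    tlift (fun x y : A => (counit x : k) *: y) (comul a) = a;
  counitr : forall a : A,
    tlift (fun x y : A => (counit y : k) *: x) (comul a) = a;
  comul1 : comul 1 = 1 ⊗ 1;
  comulM : forall a b : A, comul (a * b) = tmul (comul a) (comul b);
  counit1 : counit 1 = 1;
  counitM : forall a b : A, counit (a * b) = counit a * counit b;
  antipodel : forall a : A,
    tlift (fun x y : A => antipode x * y) (comul a) = (counit a : k)%:A;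
  antipoder : forall a : A,
    tlift (fun x y : A => x * antipode y) (comul a) = (counit a : k)%:A }.

#[short(type="hopfAlgType")]
HB.structure Definition HopfAlgebra (k : fieldType) :=
  { A of Falgebra_isHopf k A & Falgebra k A }.

Arguments comul {k s}.
Arguments counit {k s}.
Arguments antipode {k s}.

Record is_hopf_iso (k : fieldType) (A B : hopfAlgType k) (f : 'Hom(A, B)) :
    Prop := HopfIso {
  hopf_iso_bij : bijective f;
  hopf_iso1 : f 1 = 1;
  hopf_isoM : forall a b, f (a * b) = f a * f b;
  hopf_iso_comul : forall a, comul (f a) = tmap f f (comul a);
  hopf_iso_counit : forall a, counit (f a) = counit a;
  hopf_iso_antipode : forall a, antipode (f a) = f (antipode a) }.

Definition hopf_isomorphic (k : fieldType) (A B : hopfAlgType k) : Prop :=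
  exists f : 'Hom(A, B), is_hopf_iso f.

Definition hopf_dual (k : fieldType) (A : hopfAlgType k) : Type :=
  'Hom(A, k^o).

Section Dual.
Variables (k : fieldType) (A : hopfAlgType k).
Local Notation D := (hopf_dual A).
Implicit Types (f g h : D) (a b c x y : A) (W : vectType k).

HB.instance Definition _ := Vector.copy D 'Hom(A, k^o).

Definition hdual_mul f g : D :=
  linfun (tlift (fun x y => f x * g y : k^o) \o comul).
Definition hdual_one : D := counit.

Lemma hdual_mul_bil f g : bilin (fun x y : A => f x * g y : k^o).
Proof.
by split=> [v|w] a x y; rewrite linearP ?mulrDr ?mulrDl -?scalerAr -?scalerAl.
Qed.

Lemma hdual_mulE f g a :
  hdual_mul f g a = tlift (fun x y => f x * g y : k^o) (comul a).
Proof. by rewrite lfunE. Qed.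

Fact hdual_mulA : associative hdual_mul.
Proof.
move=> f g h; apply/lfunP=> a; rewrite !hdual_mulE.
pose T3 := tlift (fun x s => f x * tlift (fun y z => g y * h z : k^o) s : k^o).
have bT3 : bilin (fun x s =>
    f x * tlift (fun y z => g y * h z : k^o) s : k^o).
  by split=> [v|w] e x y; rewrite linearP ?mulrDr ?mulrDl -?scalerAr -?scalerAl.
have <- : T3 (tmap idfun comul (comul a)) =
    tlift (fun x y => f x * hdual_mul g h y : k^o) (comul a).
  move: (comul a); apply: tens_ext => [e s t|e s t|x y].
  - by rewrite /T3 /tmap !linearP.
  - by rewrite linearP.
  - rewrite tmapE // => [|e s t]; last by rewrite linearP.
    by rewrite /T3 (tliftE bT3) tliftE ?hdual_mulE //; apply: hdual_mul_bil.
rewrite -comulA; move: (comul a); apply: tens_ext => [e s t|e s t|x y].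
- by rewrite /T3 /tmap /tassoc !linearP.
- by rewrite linearP.
rewrite tmapE // => [|e s t]; last by rewrite linearP.
rewrite tliftE ?hdual_mulE; last exact: hdual_mul_bil.
move: (comul x); apply: tens_ext => [e s t|e s t|u v] /=.
- by rewrite (bilinPl (tens_bilin _ _)) /T3 /tassoc !linearP.
- by rewrite linearP mulrDl -scalerAl.
rewrite tassocE /T3 (tliftE bT3) !tliftE; do ?exact: hdual_mul_bil.
by rewrite mulrA.
Qed.

Fact hdual_mul1 : left_id hdual_one hdual_mul.
Proof.
move=> f; apply/lfunP=> a; rewrite hdual_mulE -[in RHS](counitl a).
by rewrite linear_tlift; apply: eq_tlift => x y; rewrite linearZ.
Qed.

Fact hdual_1mul : right_id hdual_one hdual_mul.
Proof.
move=> f; apply/lfunP=> a; rewrite hdual_mulE -[in RHS](counitr a).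
rewrite linear_tlift; apply: eq_tlift => x y.
by rewrite linearZ mulrC.
Qed.

Lemma hdual_mul_bilin : bilin hdual_mul.
Proof.
split=> [f|g] e s t; apply/lfunP=> a;
  rewrite add_lfunE scale_lfunE !hdual_mulE -tlift_comb;
  apply: eq_tlift => x y; rewrite add_lfunE scale_lfunE.
  by rewrite mulrDr -scalerAr.
by rewrite mulrDl -scalerAl.
Qed.

Fact hdual_mulDl : left_distributive hdual_mul +%R.
Proof.
by move=> f g h; rewrite -[f]scale1r (bilinPl hdual_mul_bilin) !scale1r.
Qed.

Fact hdual_mulDr : right_distributive hdual_mul +%R.
Proof.
by move=> f g h; rewrite -[g]scale1r (bilinPr hdual_mul_bilin) !scale1r.
Qed.

Fact hdual_oner_neq0 : hdual_one != 0.
Proof.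
apply/eqP=> /lfunP/(_ 1); rewrite zero_lfunE counit1.
by move/eqP; rewrite oner_eq0.
Qed.

HB.instance Definition _ := GRing.Zmodule_isNzRing.Build D
  hdual_mulA hdual_mul1 hdual_1mul hdual_mulDl hdual_mulDr hdual_oner_neq0.

Fact hdual_scalerAl (e : k) f g : e *: (f * g) = (e *: f) * g.
Proof.
by have := bilinPl hdual_mul_bilin g e f 0;
  rewrite (bilin0l hdual_mul_bilin) !addr0.
Qed.
HB.instance Definition _ :=
  GRing.Lmodule_isLalgebra.Build k D hdual_scalerAl.

Fact hdual_scalerAr (e : k) f g : e *: (f * g) = f * (e *: g).
Proof.
by have := bilinPr hdual_mul_bilin f e g 0;
  rewrite (bilin0r hdual_mul_bilin) !addr0.
Qed.
HB.instance Definition _ :=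
  GRing.Lalgebra_isAlgebra.Build k D hdual_scalerAr.
HB.instance Definition _ := Algebra_isFalgebra.Build k D.

Lemma dualM f g a : (f * g) a = tlift (fun x y => f x * g y : k^o) (comul a).
Proof. exact: hdual_mulE. Qed.

Lemma dual1 a : (1 : D) a = counit a. Proof. by []. Qed.

Definition hdual_coord (i : 'I_(\dim {:A})) : A -> k^o :=
  coord (vbasis {:A}) i.
Fact hdual_coord_linear i : linear (hdual_coord i).
Proof. by move=> e x y; rewrite /hdual_coord linearP. Qed.
HB.instance Definition _ i :=
  GRing.isLinear.Build k A k^o _ (hdual_coord i) (hdual_coord_linear i).

(* The transpose of the multiplication of A, written in the dual basis of
   [vbasis {:A}]; it satisfies <comul f, a ⊗ b> = f (a * b), see
   [hdual_ev_comul]. *)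
Definition hdual_comul f : tensor D D :=
  \sum_i (linfun (hdual_coord i) : D) ⊗ (f \o amull (vbasis {:A})`_i)%VF.

Definition hdual_counit f : k^o := f 1.

Definition hdual_antipode f : D := (f \o antipode)%VF.

Fact hdual_comul_linear : linear hdual_comul.
Proof.
move=> e f g; rewrite /hdual_comul scaler_sumr -big_split.
apply: eq_bigr => i _ /=.
by rewrite comp_lfunDl -comp_lfunZl (bilinPr (tens_bilin _ _)).
Qed.
Fact hdual_counit_linear : linear hdual_counit.
Proof. by move=> e f g; rewrite /hdual_counit add_lfunE scale_lfunE. Qed.
Fact hdual_antipode_linear : linear hdual_antipode.
Proof.
by move=> e f g; rewrite /hdual_antipode comp_lfunDl -comp_lfunZl.
Qed.
HB.instance Definition _ := GRing.isLinear.Build k D (tensor D D) _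
  hdual_comul hdual_comul_linear.
HB.instance Definition _ := GRing.isLinear.Build k D k^o _
  hdual_counit hdual_counit_linear.
HB.instance Definition _ := GRing.isLinear.Build k D D _
  hdual_antipode hdual_antipode_linear.

(* Evaluation of the left factor of A^* ⊗ W at a vector of A. *)
Definition hdual_ev (W : vectType k) (t : tensor D W) a : W :=
  tlift (fun (f : D) w => f a *: w) t.

Lemma hdual_ev_bilin W a : bilin (fun (f : D) (w : W) => f a *: w).
Proof.
split=> [f|w] e x y; first by rewrite scalerDr !scalerA mulrC.
by rewrite add_lfunE scale_lfunE scalerDl scalerA.
Qed.

Lemma hdual_ev_tens W (f : D) (w : W) a : hdual_ev (f ⊗ w) a = f a *: w.
Proof. exact: (tliftE (hdual_ev_bilin W a)). Qed.

Lemma hdual_evP W a : linear (fun t : tensor D W => hdual_ev t a).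
Proof. by move=> e s t; rewrite /hdual_ev linearP. Qed.

Lemma hdual_coordK f :
  f = \sum_(i < \dim {:A}) f (vbasis {:A})`_i *: linfun (hdual_coord i).
Proof.
apply/lfunP=> a; rewrite {1}(coord_vbasis (memvf a)) linear_sum sum_lfunE.
by apply: eq_bigr => i _; rewrite linearZ scale_lfunE lfunE; apply: mulrC.
Qed.

Lemma hdual_evK W (t : tensor D W) :
  t = \sum_i (linfun (hdual_coord i) : D) ⊗ hdual_ev t (vbasis {:A})`_i.
Proof.
have bt := tens_bilin D W.
pose F (s : tensor D W) :=
  \sum_i (linfun (hdual_coord i) : D) ⊗ hdual_ev s (vbasis {:A})`_i.
rewrite -[RHS]/(F t); move: t.
apply: (@tens_ext _ _ _ _ id F) => [//|e s t|f w].
  rewrite /F scaler_sumr -big_split; apply: eq_bigr => i _ /=.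
  by rewrite hdual_evP (bilinPr bt).
rewrite {1}[f]hdual_coordK (bilin_suml bt); apply: eq_bigr => i _.
rewrite hdual_ev_tens -[f _ *: w]addr0 (bilinPr bt).
by rewrite (bilin0r bt) addr0.
Qed.

Lemma hdual_ev_inj W (s t : tensor D W) :
  (forall a, hdual_ev s a = hdual_ev t a) -> s = t.
Proof.
by move=> st; rewrite (hdual_evK s) (hdual_evK t); apply: eq_bigr => i _;
  rewrite st.
Qed.

Lemma hdual_ev2_inj (s t : tensor D D) :
  (forall a b, hdual_ev s a b = hdual_ev t a b) -> s = t.
Proof. by move=> st; apply: hdual_ev_inj => a; apply/lfunP=> b. Qed.

Lemma hdual_ev_comul_lfun f a : hdual_ev (hdual_comul f) a = (f \o amull a)%VF.
Proof.
rewrite /hdual_ev linear_sum; apply/lfunP=> b.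
rewrite sum_lfunE [in RHS](coord_vbasis (memvf a)) comp_lfunE linear_sum.
rewrite sum_lfunE linear_sum; apply: eq_bigr => i _.
rewrite /= (tliftE (hdual_ev_bilin _ _)) scale_lfunE lfunE comp_lfunE.
by rewrite linearZ scale_lfunE linearZ.
Qed.

Lemma hdual_ev_comul f a b : hdual_ev (hdual_comul f) a b = f (a * b).
Proof. by rewrite hdual_ev_comul_lfun comp_lfunE lfunE. Qed.

Lemma hdual_comul_lfunE f : linfun hdual_comul f = hdual_comul f.
Proof. by rewrite lfunE. Qed.

Lemma hdual_ev_mul f g a b : hdual_ev (f ⊗ g) a b = f a * g b.
Proof. by rewrite hdual_ev_tens scale_lfunE. Qed.

Fact hdual_comulA f :
  tassoc (tmap (linfun hdual_comul) idfun (linfun hdual_comul f)) =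
  tmap idfun (linfun hdual_comul) (linfun hdual_comul f).
Proof.
rewrite !hdual_comul_lfunE.
apply: hdual_ev_inj => a; apply: hdual_ev2_inj => b c.
transitivity (hdual_ev (hdual_comul f) (a * b) c); last first.
  rewrite hdual_ev_comul -mulrA -hdual_ev_comul.
  move: (hdual_comul f); apply: tens_ext => [e s t|e s t|g h].
  - by rewrite hdual_evP add_lfunE scale_lfunE.
  - by rewrite /tmap linearP !hdual_evP add_lfunE scale_lfunE.
  rewrite tmapE // => [|e s t]; last by rewrite linearP.
  rewrite hdual_ev_mul hdual_ev_tens hdual_comul_lfunE.
  have := hdual_evP (W := D) b (g a) (hdual_comul h) 0; rewrite addr0 => ->.
  by rewrite add_lfunE scale_lfunE /hdual_ev linear0 zero_lfunE addr0 -/(hdual_ev _ _) hdual_ev_comul.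
move: (hdual_comul f); apply: tens_ext => [e s t|e s t|g h].
- by rewrite /tmap /tassoc !linearP !hdual_evP add_lfunE scale_lfunE.
- by rewrite hdual_evP add_lfunE scale_lfunE.
rewrite tmapE // => [|e s t]; last by rewrite linearP.
rewrite hdual_comul_lfunE hdual_ev_mul -hdual_ev_comul.
move: (hdual_comul g); apply: tens_ext => [e s t|e s t|u v] /=.
- rewrite (bilinPl (tens_bilin _ _)) /tassoc !linearP !hdual_evP.
  by rewrite add_lfunE scale_lfunE.
- by rewrite hdual_evP add_lfunE scale_lfunE mulrDl -scalerAl.
rewrite tassocE hdual_ev_tens.
have := hdual_evP (W := D) b (u a) (v ⊗ h) 0; rewrite addr0 => ->.
rewrite add_lfunE scale_lfunE {2}/hdual_ev linear0 zero_lfunE addr0.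
by rewrite !hdual_ev_mul; apply: mulrA.
Qed.

Fact hdual_counitl f :
  tlift (fun g h : D => (linfun hdual_counit g : k) *: h)
    (linfun hdual_comul f) = f.
Proof.
rewrite hdual_comul_lfunE.
transitivity (hdual_ev (hdual_comul f) 1).
  by apply: eq_tlift => g h; rewrite lfunE.
by rewrite hdual_ev_comul_lfun amull1 comp_lfun1r.
Qed.

Fact hdual_counitr f :
  tlift (fun g h : D => (linfun hdual_counit h : k) *: g)
    (linfun hdual_comul f) = f.
Proof.
rewrite hdual_comul_lfunE; apply/lfunP=> a.
transitivity (hdual_ev (hdual_comul f) a 1); last first.
  by rewrite hdual_ev_comul mulr1.
move: (hdual_comul f); apply: tens_ext => [e s t|e s t|g h].
- by rewrite linearP add_lfunE scale_lfunE.
- by rewrite hdual_evP add_lfunE scale_lfunE.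
rewrite hdual_ev_mul tliftE ?scale_lfunE ?lfunE; first exact: mulrC.
split=> [u|u] e x y; last by rewrite scalerDr !scalerA mulrC.
by rewrite linearP scalerDl scalerA.
Qed.

Fact hdual_comul1 : linfun hdual_comul 1 = 1 ⊗ 1.
Proof.
rewrite hdual_comul_lfunE; apply: hdual_ev2_inj => a b.
by rewrite hdual_ev_comul hdual_ev_mul !dual1 counitM.
Qed.

Lemma hdual_ev_tmul (s t : tensor D D) a b :
  hdual_ev (tmul s t) a b =
  tlift (fun x y =>
    tlift (fun x' y' => hdual_ev s x x' * hdual_ev t y y' : k^o) (comul b))
    (comul a).
Proof.
move: s; apply: tens_ext => [e s s'|e s s'|f f'].
- by rewrite (bilinPl (tmul_bilin D)) hdual_evP add_lfunE scale_lfunE.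
- rewrite -tlift_comb; apply: eq_tlift => x y.
  rewrite -tlift_comb; apply: eq_tlift => x' y'.
  by rewrite hdual_evP add_lfunE scale_lfunE mulrDl -scalerAl.
move: t; apply: tens_ext => [e t t'|e t t'|g g'].
- by rewrite (bilinPr (tmul_bilin D)) hdual_evP add_lfunE scale_lfunE.
- rewrite -tlift_comb; apply: eq_tlift => x y.
  rewrite -tlift_comb; apply: eq_tlift => x' y'.
  by rewrite hdual_evP add_lfunE scale_lfunE mulrDr -scalerAr.
have E (c d : k^o) : c * d = c *: d by [].
rewrite tmulE hdual_ev_mul !dualM [LHS]mulrC [LHS]E.
apply: (etrans (tliftZ _ _ _)); apply: eq_tlift => x y.
rewrite -[LHS]E [LHS]mulrC [LHS]E.
apply: (etrans (tliftZ _ _ _)); apply: eq_tlift => x' y'.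
rewrite -[LHS]E.
by rewrite !hdual_ev_mul; apply: mulrACA.
Qed.

Fact hdual_comulM f g :
  linfun hdual_comul (f * g) = tmul (linfun hdual_comul f) (linfun hdual_comul g).
Proof.
rewrite !hdual_comul_lfunE; apply: hdual_ev2_inj => a b.
rewrite hdual_ev_comul dualM comulM hdual_ev_tmul /tmul linear_tlift.
apply: eq_tlift => x y; rewrite linear_tlift; apply: eq_tlift => x' y'.
by rewrite !hdual_ev_comul /= tliftE //; apply: hdual_mul_bil.
Qed.

Fact hdual_counit1 : linfun hdual_counit 1 = 1.
Proof. by rewrite lfunE /= /hdual_counit dual1 counit1. Qed.

Fact hdual_counitM f g :
  linfun hdual_counit (f * g) = linfun hdual_counit f * linfun hdual_counit g.
Proof.
rewrite !lfunE /= /hdual_counit dualM comul1 tliftE //.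
exact: hdual_mul_bil.
Qed.

Lemma dual_mul_bilin : bilin (fun f g : D => f * g).
Proof. exact: mul_bilin. Qed.

Fact hdual_antipodel f :
  tlift (fun g h : D => linfun hdual_antipode g * h) (linfun hdual_comul f) =
  (linfun hdual_counit f : k)%:A.
Proof.
rewrite hdual_comul_lfunE; apply/lfunP=> a.
transitivity
  (tlift (fun x y => hdual_ev (hdual_comul f) (antipode x) y) (comul a)).
  move: (hdual_comul f); apply: tens_ext => [e s t|e s t|g h].
  - by rewrite linearP add_lfunE scale_lfunE.
  - rewrite -tlift_comb; apply: eq_tlift => x y.
    by rewrite hdual_evP add_lfunE scale_lfunE.
  rewrite tliftE; last first.
    split=> [u|u] e x y; first by rewrite (bilinPr dual_mul_bilin).
    by rewrite linearP (bilinPl dual_mul_bilin).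
  rewrite dualM; apply: eq_tlift => x y.
  by rewrite lfunE hdual_ev_mul /= comp_lfunE.
rewrite scale_lfunE dual1 lfunE /= /hdual_counit.
transitivity (f ((counit a : k) *: (1 : A))); last by rewrite linearZ; apply: mulrC.
rewrite -antipodel linear_tlift; apply: eq_tlift => x y.
by rewrite hdual_ev_comul.
Qed.

Fact hdual_antipoder f :
  tlift (fun g h : D => g * linfun hdual_antipode h) (linfun hdual_comul f) =
  (linfun hdual_counit f : k)%:A.
Proof.
rewrite hdual_comul_lfunE; apply/lfunP=> a.
transitivity
  (tlift (fun x y => hdual_ev (hdual_comul f) x (antipode y)) (comul a)).
  move: (hdual_comul f); apply: tens_ext => [e s t|e s t|g h].
  - by rewrite linearP add_lfunE scale_lfunE.
  - rewrite -tlift_comb; apply: eq_tlift => x y.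
    by rewrite hdual_evP add_lfunE scale_lfunE.
  rewrite tliftE; last first.
    split=> [u|u] e x y; last by rewrite (bilinPl dual_mul_bilin).
    by rewrite linearP (bilinPr dual_mul_bilin).
  rewrite dualM; apply: eq_tlift => x y.
  by rewrite lfunE hdual_ev_mul /= comp_lfunE.
rewrite scale_lfunE dual1 lfunE /= /hdual_counit.
transitivity (f ((counit a : k) *: (1 : A))); last by rewrite linearZ; apply: mulrC.
rewrite -antipoder linear_tlift; apply: eq_tlift => x y.
by rewrite hdual_ev_comul.
Qed.

HB.instance Definition _ := Falgebra_isHopf.Build k D hdual_comulA
  hdual_counitl hdual_counitr hdual_comul1 hdual_comulM hdual_counit1
  hdual_counitM hdual_antipodel hdual_antipoder.

End Dual.

Definition group_algebra (k : fieldType) (gT : finGroupType) : Type :=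
  {ffun gT -> k^o}.

Section GroupAlgebra.
Variables (k : fieldType) (gT : finGroupType).
Local Notation kG := (group_algebra k gT).
Implicit Types (u v w : kG) (g h : gT).

HB.instance Definition _ := Vector.copy kG {ffun gT -> k^o}.

Definition gelt g : kG := [ffun h => (h == g)%:R].

Lemma gelt_sum u : u = \sum_g u g *: gelt g.
Proof.
apply/ffunP=> h; rewrite sum_ffunE (bigD1 h) //= big1 => [|g ne_gh].
  by rewrite !ffunE eqxx addr0 [RHS]mulr1.
by rewrite !ffunE eq_sym (negPf ne_gh) [LHS]mulr0.
Qed.

(* The linear extension to k[G] of a map defined on G. *)
Definition glift (V : vectType k) (F : gT -> V) u : V := \sum_g u g *: F g.

Fact glift_linear (V : vectType k) (F : gT -> V) : linear (glift F).
Proof.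
move=> a u v; rewrite scaler_sumr -big_split; apply: eq_bigr => g _ /=.
by rewrite !ffunE scalerDl scalerA.
Qed.
HB.instance Definition _ (V : vectType k) (F : gT -> V) :=
  GRing.isLinear.Build k kG V _ (glift F) (glift_linear F).

Lemma gliftE (V : vectType k) (F : gT -> V) g : glift F (gelt g) = F g.
Proof.
rewrite /glift (bigD1 g) //= big1 => [|h ne_hg].
  by rewrite ffunE eqxx scale1r addr0.
by rewrite ffunE (negPf ne_hg) scale0r.
Qed.

Lemma gelt_ext (V : vectType k) (F G : kG -> V) : linear F -> linear G ->
  (forall g, F (gelt g) = G (gelt g)) -> F =1 G.
Proof.
move=> FL GL FG u.
pose F' : {linear _ -> _} := HB.pack F (GRing.isLinear.Build k _ _ _ F FL).
pose G' : {linear _ -> _} := HB.pack G (GRing.isLinear.Build k _ _ _ G GL).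
rewrite [u]gelt_sum -[LHS]/(F' _) -[RHS]/(G' _) !linear_sum.
by apply: eq_bigr => g _; rewrite !linearZ /= FG.
Qed.

Definition galg_mul u v : kG :=
  glift (fun g => glift (fun h => gelt (g * h)%g) v) u.

Lemma galg_mulE g h : galg_mul (gelt g) (gelt h) = gelt (g * h)%g.
Proof. by rewrite /galg_mul !gliftE. Qed.

Lemma glift_comb (V : vectType k) (F G : gT -> V) a u :
  glift (fun g => a *: F g + G g) u = a *: glift F u + glift G u.
Proof.
rewrite /glift scaler_sumr -big_split; apply: eq_bigr => g _ /=.
by rewrite scalerDr !scalerA mulrC.
Qed.

Lemma eq_glift (V : vectType k) (F G : gT -> V) : F =1 G -> glift F =1 glift G.
Proof. by move=> FG u; apply: eq_bigr => g _; rewrite FG. Qed.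

Lemma galg_mul_bilin : bilin galg_mul.
Proof.
split=> [u|v] a x y; last by rewrite /galg_mul linearP.
by rewrite /galg_mul -glift_comb; apply: eq_glift => g; rewrite linearP.
Qed.

Fact galg_mulA : associative galg_mul.
Proof.
have bm := galg_mul_bilin.
move=> u v w; move: u; apply: gelt_ext => [e x y|e x y|g];
  rewrite ?(bilinPl bm) //.
move: v; apply: gelt_ext => [e x y|e x y|h];
  rewrite ?(bilinPl bm) ?(bilinPr bm) ?(bilinPl bm) //.
move: w; apply: gelt_ext => [e x y|e x y|l]; rewrite ?(bilinPr bm) //.
by rewrite !galg_mulE mulgA.
Qed.

Fact galg_mul1 : left_id (gelt 1%g) galg_mul.
Proof.
have bm := galg_mul_bilin.
apply: gelt_ext => [e x y|//|g]; first by rewrite (bilinPr bm).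
by rewrite galg_mulE mul1g.
Qed.

Fact galg_1mul : right_id (gelt 1%g) galg_mul.
Proof.
have bm := galg_mul_bilin.
apply: gelt_ext => [e x y|//|g]; first by rewrite (bilinPl bm).
by rewrite galg_mulE mulg1.
Qed.

Fact galg_mulDl : left_distributive galg_mul +%R.
Proof.
by move=> u v w; rewrite -[u]scale1r (bilinPl galg_mul_bilin) !scale1r.
Qed.

Fact galg_mulDr : right_distributive galg_mul +%R.
Proof.
by move=> u v w; rewrite -[v]scale1r (bilinPr galg_mul_bilin) !scale1r.
Qed.

Fact galg_oner_neq0 : gelt 1%g != 0.
Proof.
apply/eqP=> /ffunP/(_ 1%g); rewrite !ffunE eqxx; apply/eqP.
exact: oner_neq0.
Qed.

HB.instance Definition _ := GRing.Zmodule_isNzRing.Build kG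
  galg_mulA galg_mul1 galg_1mul galg_mulDl galg_mulDr galg_oner_neq0.

Fact galg_scalerAl (e : k) u v : e *: (u * v) = (e *: u) * v.
Proof.
by have := bilinPl galg_mul_bilin v e u 0;
  rewrite (bilin0l galg_mul_bilin) !addr0.
Qed.
HB.instance Definition _ := GRing.Lmodule_isLalgebra.Build k kG galg_scalerAl.

Fact galg_scalerAr (e : k) u v : e *: (u * v) = u * (e *: v).
Proof.
by have := bilinPr galg_mul_bilin u e v 0;
  rewrite (bilin0r galg_mul_bilin) !addr0.
Qed.
HB.instance Definition _ := GRing.Lalgebra_isAlgebra.Build k kG galg_scalerAr.
HB.instance Definition _ := Algebra_isFalgebra.Build k kG.

Lemma geltM g h : gelt g * gelt h = gelt (g * h)%g.
Proof. exact: galg_mulE. Qed.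
Lemma gelt1 : gelt 1%g = 1. Proof. by []. Qed.

Definition galg_comul : 'Hom(kG, tensor kG kG) :=
  linfun (glift (fun g => gelt g ⊗ gelt g)).
Definition galg_counit : 'Hom(kG, k^o) := linfun (glift (fun=> 1 : k^o)).
Definition galg_antipode : 'End(kG) := linfun (glift (fun g => gelt g^-1%g)).

Lemma galg_comulE g : galg_comul (gelt g) = gelt g ⊗ gelt g.
Proof. by rewrite lfunE /= gliftE. Qed.
Lemma galg_counitE g : galg_counit (gelt g) = 1.
Proof. by rewrite lfunE /= gliftE. Qed.
Lemma galg_antipodeE g : galg_antipode (gelt g) = gelt g^-1%g.
Proof. by rewrite lfunE /= gliftE. Qed.

Fact galg_comulA u :
  tassoc (tmap galg_comul idfun (galg_comul u)) =
  tmap idfun galg_comul (galg_comul u).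
Proof.
move: u; apply: gelt_ext => [e x y|e x y|g].
- by rewrite /tassoc /tmap !linearP.
- by rewrite /tmap !linearP.
rewrite galg_comulE !tmapE //; do ?exact: linear_id_lfun.
by rewrite galg_comulE tassocE.
Qed.

Fact galg_counitl u :
  tlift (fun x y : kG => (galg_counit x : k) *: y) (galg_comul u) = u.
Proof.
move: u; apply: gelt_ext => [e x y|//|g]; first by rewrite !linearP.
rewrite galg_comulE tliftE ?galg_counitE ?scale1r //.
split=> [v|v] e x y; first by rewrite scalerDr !scalerA mulrC.
by rewrite linearP scalerDl scalerA.
Qed.

Fact galg_counitr u :
  tlift (fun x y : kG => (galg_counit y : k) *: x) (galg_comul u) = u.
Proof.
move: u; apply: gelt_ext => [e x y|//|g]; first by rewrite !linearP.
rewrite galg_comulE tliftE ?galg_counitE ?scale1r //.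
split=> [v|v] e x y; last by rewrite scalerDr !scalerA mulrC.
by rewrite linearP scalerDl scalerA.
Qed.

Fact galg_comul1 : galg_comul 1 = 1 ⊗ 1.
Proof. by rewrite -gelt1 galg_comulE. Qed.

Fact galg_comulM u v : galg_comul (u * v) = tmul (galg_comul u) (galg_comul v).
Proof.
have bm := mul_bilin kG; have bt := tmul_bilin kG.
move: u; apply: gelt_ext => [e x y|e x y|g].
- by rewrite (bilinPl bm) linearP.
- by rewrite linearP (bilinPl bt).
move: v; apply: gelt_ext => [e x y|e x y|h].
- by rewrite (bilinPr bm) linearP.
- by rewrite linearP (bilinPr bt).
by rewrite geltM !galg_comulE tmulE geltM.
Qed.

Fact galg_counit1 : galg_counit 1 = 1.
Proof. by rewrite -gelt1 galg_counitE. Qed.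

Fact galg_counitM u v : galg_counit (u * v) = galg_counit u * galg_counit v.
Proof.
have bm := mul_bilin kG.
move: u; apply: gelt_ext => [e x y|e x y|g].
- by rewrite (bilinPl bm) linearP.
- by rewrite linearP mulrDl -scalerAl.
move: v; apply: gelt_ext => [e x y|e x y|h].
- by rewrite (bilinPr bm) linearP.
- by rewrite linearP mulrDr -scalerAr.
by rewrite geltM !galg_counitE mulr1.
Qed.

Fact galg_antipodel u :
  tlift (fun x y : kG => galg_antipode x * y) (galg_comul u) =
  (galg_counit u : k)%:A.
Proof.
have bm := mul_bilin kG.
move: u; apply: gelt_ext => [e x y|e x y|g].
- by rewrite !linearP.
- by rewrite linearP scalerDl scalerA.
rewrite galg_comulE galg_counitE scale1r tliftE; last first.
  split=> [v|v] e x y; first by rewrite (bilinPr bm).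
  by rewrite linearP (bilinPl bm).
by rewrite galg_antipodeE geltM mulVg.
Qed.

Fact galg_antipoder u :
  tlift (fun x y : kG => x * galg_antipode y) (galg_comul u) =
  (galg_counit u : k)%:A.
Proof.
have bm := mul_bilin kG.
move: u; apply: gelt_ext => [e x y|e x y|g].
- by rewrite !linearP.
- by rewrite linearP scalerDl scalerA.
rewrite galg_comulE galg_counitE scale1r tliftE; last first.
  split=> [v|v] e x y; last by rewrite (bilinPl bm).
  by rewrite linearP (bilinPr bm).
by rewrite galg_antipodeE geltM mulgV.
Qed.

HB.instance Definition _ := Falgebra_isHopf.Build k kG galg_comulA
  galg_counitl galg_counitr galg_comul1 galg_comulM galg_counit1
  galg_counitM galg_antipodel galg_antipoder.

End GroupAlgebra.

Definition is_group_algebra (k : fieldType) (A : hopfAlgType k) : Prop :=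
  exists gT : finGroupType, hopf_isomorphic A (group_algebra k gT).

(* Every irreducible representation of a finite-dimensional algebra is
   finite-dimensional, so V may be restricted to vectTypes. *)

Section Representations.
Variables (k : fieldType) (A : falgType k) (V : vectType k).
Implicit Types (rho : A -> 'End(V)) (W : {vspace V}).

Definition is_representation rho : Prop :=
  [/\ linear rho, rho 1 = \1%VF & forall a b, rho (a * b) = (rho a \o rho b)%VF].

Definition subrep rho W : Prop := forall a, (rho a @: W <= W)%VS.

Definition irreducible rho : Prop :=
  ({:V} != 0)%VS /\ forall W, subrep rho W -> W = 0%VS \/ W = {:V}%VS.

Definition completely_reducible rho : Prop :=
  forall W, subrep rho W ->
  exists W', [/\ subrep rho W', (W + W' = {:V})%VS & (W :&: W' = 0)%VS].

End Representations.

(* [amull] is the left regular representation. *)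
Lemma amull_representation (k : fieldType) (A : falgType k) :
  is_representation (@amull k A).
Proof.
split=> [a x y||a b]; [by rewrite linearP | exact: amull1 |].
by apply/lfunP=> x; rewrite comp_lfunE !lfunE /= mulrA.
Qed.

Definition semisimple (k : fieldType) (A : falgType k) : Prop :=
  completely_reducible (@amull k A).

(* Being of Frobenius type is defined for semisimple Hopf algebras only, so it
   includes semisimplicity. *)
Definition frobenius_type (k : fieldType) (H : hopfAlgType k) : Prop :=
  semisimple H /\
  forall (V : vectType k) (rho : H -> 'End(V)),
    is_representation rho -> irreducible rho -> (\dim {:V} %| \dim {:H})%N.

(* Main.v *)
(** Let H = A^*.  The grouplikes of A form a finite group G, whose elements are
    the one-dimensional representations of H.  An irreducible representation of
    H has dimension d dividing pq with d^2 <= pq, so d is 1 or p, and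
    pq = |G| + c p^2.  In particular p divides |G|; write |G| = p m, so that
    q = m + c p.  If m = 1, then q = 1 mod p.  Otherwise some prime r <> p
    divides m, and G has an element of order r; then r divides dim A = pq, so
    r = q, |G| = pq, and the grouplikes, being linearly independent, form a
    basis of A.

    That the prime order r of a grouplike g divides dim A needs no freeness
    theorem: a ⊗ b |-> a_(1) ⊗ a_(2) b turns L_g ⊗ id into L_g ⊗ L_g, so every
    grouplike h satisfies tr(L_h)^2 = dim A tr(L_h); averaging the traces of the
    powers of g gives the rank of an idempotent, hence an integrality
    condition. *)

Require Import Defs.
From HB Require Import structures.
From mathcomp Require Import all_boot all_order all_fingroup all_algebra all_field.
From mathcomp Require Import pgroup.
From Stdlib Require Import Classical.

Set Implicit Arguments.
Unset Strict Implicit.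
Unset Printing Implicit Defensive.

Import GRing.Theory.
Local Open Scope ring_scope.
Local Open Scope tensor_scope.

(** * Minimal idempotents *)

(** The characteristic polynomial of the restriction of [f] to [W] has positive degree [\dim W],
    hence a root. *)
Lemma closed_field_eigenvector (k : closedFieldType) (V : vectType k)
    (f : 'End(V)) (W : {vspace V}) : W != 0%VS -> (f @: W <= W)%VS ->
  exists a : k, exists2 v, v \in W & v != 0 /\ f v = a *: v.
Proof.
move=> W0 fW; pose b := vbasis W.
have bfree : free b := basis_free (vbasisP W).
pose M : 'M_(\dim W) := \matrix_(i, j) coord b j (f b`_i).
have fb (i : 'I_(\dim W)) : f b`_i = \sum_j M i j *: b`_j.
  have: f b`_i \in W.
    by rewrite (subvP fW) // memv_img // vbasis_mem // mem_nth // size_tuple.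
  by move/coord_vbasis=> {1}->; apply: eq_bigr => j _; rewrite mxE.
have [a]: exists a, root (char_poly M) a.
  by apply/closed_rootP; rewrite size_char_poly eqSS dimv_eq0.
rewrite -eigenvalue_root_char => /eigenvalueP[v vM v0].
exists a, (\sum_i v 0 i *: b`_i).
  by apply: memv_suml => i _; rewrite memvZ // vbasis_mem // mem_nth // size_tuple.
split.
  apply: contraNneq v0; have /freeP bf := bfree; move=> /bf v0; apply/eqP/rowP=> i.
  by rewrite mxE v0.
rewrite linear_sum scaler_sumr.
under eq_bigr => i _ do rewrite linearZ /= fb scaler_sumr.
rewrite exchange_big /=; apply: eq_bigr => j _.
under eq_bigr => i _ do rewrite scalerA.
rewrite -scaler_suml scalerA; congr (_ *: _).
by have /rowP/(_ j) := vM; rewrite !mxE.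
Qed.

(* e is idempotent and H e is a minimal left ideal: H x = H e for every nonzero
   x in H e. *)
Definition min_idem (k : fieldType) (H : falgType k) (e : H) : Prop :=
  [/\ e * e = e, e != 0 & forall x, x * e = x -> x != 0 -> exists y, y * x = e].

Lemma limg_amulrP (k : fieldType) (H : falgType k) (e x : H) :
  e * e = e -> reflect (x * e = x) (x \in limg (amulr e)).
Proof.
move=> ee; apply: (iffP memv_imgP) => [[y _ ->]|xe].
  by rewrite lfunE /= -mulrA ee.
by exists x; rewrite ?memvf // lfunE.
Qed.

Section MinimalIdempotents.
Variables (k : closedFieldType) (H : falgType k).
Implicit Types (e f x y : H).

(** Schur's lemma in the form [e H e = k e]. Right multiplication by [x] has an eigenvector [v] in
    [H e]; minimality gives [u * v = e], so [v * (x - a *: e) = 0] yields [x = a *: e]. *)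
Lemma min_idem_scalar e x : min_idem e -> e * x = x -> x * e = x ->
  exists a : k, x = a *: e.
Proof.
case=> ee e0 emin ex xe.
have eW : e \in limg (amulr e) by apply/limg_amulrP.
have [||a [v /(limg_amulrP _ ee) ve [v0]]] :=
    @closed_field_eigenvector k H (amulr x) (limg (amulr e)).
- by apply: contraNneq e0 => W0; rewrite -memv0 -W0.
- apply/subvP=> _ /memv_imgP[w /(limg_amulrP _ ee) we ->].
  by apply/(limg_amulrP _ ee); rewrite lfunE /= -mulrA xe.
rewrite lfunE /= => vx; exists a; have [u uv] := emin v ve v0.
have vz : v * (x - a *: e) = 0 by rewrite mulrBr vx -scalerAr ve subrr.
apply/eqP; rewrite -subr_eq0; apply/eqP.
have <- : e * (x - a *: e) = x - a *: e by rewrite mulrBr ex -scalerAr ee.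
by rewrite -{1}uv -mulrA vz mulr0.
Qed.

(** Minimality of [f] gives [y * x = f]; then [x * y] is a multiple of [e] by Schur's lemma, and
    [x * y * x = x] forces the scalar to be 1. *)
Lemma min_idem_inv e f x : min_idem e -> min_idem f -> e * x = x -> x * f = x ->
  x != 0 -> exists y, [/\ f * y = y, y * e = y, y * x = f & x * y = e].
Proof.
move=> em [ff f0 fmin] ex xf x0; have [ee _ _] := em.
have [y0 y0x] := fmin x xf x0; pose y := f * y0 * e.
have fy : f * y = y by rewrite /y !mulrA ff.
have ye : y * e = y by rewrite /y -!mulrA ee.
have yx : y * x = f by rewrite /y -mulrA ex -mulrA y0x ff.
have [| | a xy] := min_idem_scalar (x := x * y) em.
- by rewrite mulrA ex.
- by rewrite -mulrA ye.
exists y; split=> //; rewrite xy.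
have: (x * y) * x = x by rewrite -mulrA yx.
rewrite xy -scalerAl ex => /eqP; rewrite -subr_eq0 -{2}[x]scale1r -scalerBl.
by rewrite scaler_eq0 (negPf x0) orbF subr_eq0 => /eqP->; rewrite scale1r.
Qed.

(** For idempotents, the Peirce component [e H f] is the space of H-linear maps from [H e] to [H f],
    acting by right multiplication. For minimal idempotents it is nonzero exactly when these left
    ideals are isomorphic. *)
Definition peirce e f : {vspace H} := limg (amulr f \o amull e).

Lemma peirceP e f x : e * e = e -> f * f = f ->
  reflect (e * x = x /\ x * f = x) (x \in peirce e f).
Proof.
move=> ee ff; apply: (iffP memv_imgP) => [[y _ ->]|[ex xf]].
  by rewrite comp_lfunE !lfunE /= !mulrA ee -!mulrA ff.
by exists x; rewrite ?memvf // comp_lfunE !lfunE /= ex xf.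
Qed.

(** If [x] is nonzero in [e H f] with inverse [y], any [z] in [e H f] is [(z * y) * x], where
    [z * y] lies in [e H e = k e]. *)
Lemma dim_peirce e f : min_idem e -> min_idem f ->
  \dim (peirce e f) = (peirce e f != 0%VS).
Proof.
move=> em fm; have [[ee _ _] [ff _ _]] := (em, fm).
have [->|P0] := eqVneq (peirce e f) 0%VS; first by rewrite dimv0.
pose x := vpick (peirce e f); have x0 : x != 0 by rewrite vpick0.
have /(peirceP _ ee ff)[ex xf] : x \in peirce e f by rewrite memv_pick.
have [y [fy ye yx xy]] := min_idem_inv em fm ex xf x0.
suff -> : peirce e f = <[x]>%VS by rewrite dim_vline x0.
apply/eqP; rewrite eqEsubv; apply/andP; split; last by rewrite -memvE memv_pick.
apply/subvP=> z /(peirceP _ ee ff)[ez zf].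
have [| | a zy] := min_idem_scalar (x := z * y) em.
- by rewrite mulrA ez.
- by rewrite -mulrA ye.
by apply/vlineP; exists a; rewrite -zf -yx mulrA zy -scalerAl ex.
Qed.

(** The mutually inverse pair makes the symmetry and transitivity of the relation immediate. *)
Lemma peirce_neq0P e f : min_idem e -> min_idem f ->
  reflect (exists x y, [/\ e * x = x, x * f = x, f * y = y, y * e = y &
                        y * x = f /\ x * y = e]) (peirce e f != 0%VS).
Proof.
move=> em fm; have [[ee e0 _] [ff _ _]] := (em, fm).
apply: (iffP idP) => [P0|[x [y [ex xf fy ye [yx xy]]]]].
  have x0 : vpick (peirce e f) != 0 by rewrite vpick0.
  have /(peirceP _ ee ff)[ex xf] := memv_pick (peirce e f).
  have [y [fy ye yx xy]] := min_idem_inv em fm ex xf x0.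
  by exists (vpick (peirce e f)), y.
apply: contraNneq e0 => P0; rewrite -xy.
have: x \in peirce e f by apply/peirceP.
by rewrite P0 memv0 => /eqP->; rewrite mul0r.
Qed.

Lemma peirce_refl e : min_idem e -> peirce e e != 0%VS.
Proof.
by move=> em; have [ee _ _] := em; apply/peirce_neq0P=> //; exists e, e; rewrite !ee.
Qed.

Lemma peirce_sym e f : min_idem e -> min_idem f ->
  (peirce e f != 0%VS) = (peirce f e != 0%VS).
Proof.
move=> em fm.
by apply/peirce_neq0P/peirce_neq0P=> // -[x [y [? ? ? ? [? ?]]]]; exists y, x.
Qed.

Lemma peirce_trans f e g : min_idem e -> min_idem f -> min_idem g ->
  peirce e f != 0%VS -> peirce f g != 0%VS -> peirce e g != 0%VS.
Proof.
move=> em fm gm /(peirce_neq0P em fm)[x [y [ex xf fy ye [yx xy]]]].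
move=> /(peirce_neq0P fm gm)[z [t [fz zg gt tf [tz zt]]]].
apply/peirce_neq0P=> //; exists (x * z), (t * y); split.
- by rewrite mulrA ex.
- by rewrite -mulrA zg.
- by rewrite mulrA gt.
- by rewrite -mulrA ye.
split.
  by rewrite mulrA -[t * y * x]mulrA yx tf tz.
by rewrite mulrA -[x * z * t]mulrA zt xf xy.
Qed.

(** Right multiplication by the [x] of such a pair embeds [H e] into [H f]; symmetry gives the other
    inequality. *)
Lemma dim_limg_amulr_peirce e f : min_idem e -> min_idem f ->
  peirce e f != 0%VS -> \dim (limg (amulr e)) = \dim (limg (amulr f)).
Proof.
have le e' f' : min_idem e' -> min_idem f' -> peirce e' f' != 0%VS ->
    (\dim (limg (amulr e')) <= \dim (limg (amulr f')))%N.
  move=> em fm /(peirce_neq0P em fm)[x [y [ex xf fy ye [yx xy]]]].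
  have [[ee _ _] [ff _ _]] := (em, fm).
  rewrite -(@limg_dim_eq _ _ _ (amulr x) (limg (amulr e'))); last first.
    apply/eqP; rewrite -subv0; apply/subvP=> z.
    rewrite memv_cap memv0 memv_ker lfunE /= => /andP[/(limg_amulrP _ ee) ze].
    by move/eqP=> zx; rewrite -ze -xy mulrA zx mul0r.
  apply/dimvS/subvP=> _ /memv_imgP[z _ ->]; apply/limg_amulrP=> //.
  by rewrite lfunE /= -mulrA xf.
move=> em fm P0; apply/eqP; rewrite eqn_leq !le //.
by rewrite peirce_sym.
Qed.

End MinimalIdempotents.

(** * Decomposition of an idempotent of a semisimple algebra into minimal ones *)

Section Decomposition.
Variables (k : fieldType) (H : falgType k).
Implicit Types (e f x y : H).

(* Split e along a left ideal H x strictly inside H e and a complement of it. *)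
Lemma semisimple_split e : semisimple H -> e * e = e -> e != 0 -> ~ min_idem e ->
  exists f f', [/\ f * f = f, f' * f' = f', f * f' = 0, f' * f = 0 &
                [/\ f + f' = e, f != 0 & f' != 0]].
Proof.
move=> ssH ee e0 nmin.
have [x [xe x0 nxe]] : exists x, [/\ x * e = x, x != 0 & forall y, y * x <> e].
  apply: NNPP => nx; apply: nmin; split=> // x xe x0.
  by apply: NNPP => ny; apply: nx; exists x; split=> // y yx; apply: ny; exists y.
have subP U : subrep (@amull k H) U -> forall a u, u \in U -> a * u \in U.
  by move=> sU a u uU; apply: (subvP (sU a)); apply/memv_imgP; exists u; rewrite ?lfunE.
pose W := limg (amulr x).
have sW : subrep (@amull k H) W.
  move=> a; apply/subvP=> _ /memv_imgP[_ /memv_imgP[y _ ->] ->].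
  by rewrite !lfunE /= mulrA; apply/memv_imgP; exists (a * y); rewrite ?memvf ?lfunE.
have [W' [sW' WW' WW0]] := ssH W sW.
have We w : w \in W -> w * e = w.
  by case/memv_imgP=> y _ ->; rewrite lfunE /= -mulrA xe.
have disj u : u \in W -> u \in W' -> u = 0.
  by move=> uW uW'; apply/eqP; rewrite -memv0 -WW0 memv_cap uW.
have /memv_addP[w wW [w' wW' w1]] : 1 \in (W + W')%VS by rewrite WW' memvf.
pose f := e * w; pose f' := e * w'.
have fW : f \in W by apply: subP.
have fW' : f' \in W' by apply: subP.
have ff'e : f + f' = e by rewrite -mulrDr -w1 mulr1.
have f'e : f' * e = f'.
  by rewrite -[f'](addKr f) ff'e mulrDl mulNr ee We.
(* The product lies in [W'], and it equals [f - f * f], which lies in [W]. *)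
have ff' : f * f' = 0.
  apply: disj; last exact: subP.
  by rewrite -(addKr (f * f) (f * f')) -mulrDr ff'e We // addrC memvB // subP.
have f'f : f' * f = 0.
  apply: disj; first exact: subP.
  by rewrite -(addrK (f' * f') (f' * f)) -mulrDr ff'e f'e memvB // subP.
exists f, f'; split=> //.
- by rewrite -[RHS]We // -ff'e mulrDr ff' addr0.
- by rewrite -[RHS]f'e -ff'e mulrDr f'f add0r.
split=> //.
  (* If [f = 0], then [x = x * f'] lies in both [W] and [W']. If [f' = 0], then [e = f] lies in
     [H x], which was excluded. *)
  apply: contraNneq x0 => f0; apply/eqP; apply: disj.
    by apply/memv_imgP; exists 1; rewrite ?memvf // lfunE /= mul1r.
  by rewrite -xe -ff'e f0 add0r subP.
apply/eqP=> f'0; move: fW; rewrite -[f]addr0 -f'0 ff'e => /memv_imgP[y _ eyx].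
by apply: (nxe y); rewrite eyx lfunE.
Qed.

(** Induction on the dimension of [H e]. The clause [e * x = x /\ x * e = x] is what makes the
    pieces of two orthogonal summands orthogonal to each other. *)
Lemma semisimple_min_idems e : semisimple H -> e * e = e ->
  exists es : seq H, [/\ uniq es, {in es, forall x, min_idem x},
    {in es &, forall x y, x != y -> x * y = 0},
    {in es, forall x, e * x = x /\ x * e = x} & \sum_(x <- es) x = e].
Proof.
move=> ssH; move: {2}_.+1 (ltnSn (\dim (limg (amulr e)))) => n.
elim: n e => // n IHn e; rewrite ltnS => dime ee.
have [->|e0] := eqVneq e 0; first by exists [::]; rewrite big_nil; split.
have [em|nem] := classic (min_idem e).
  exists [:: e]; rewrite big_seq1; split=> //.
  - by move=> x; rewrite inE => /eqP->.
  - by move=> x y; rewrite !inE => /eqP-> /eqP->; rewrite eqxx.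
  - by move=> x; rewrite inE => /eqP->.
have [f [f' [ff f'f' ff' f'f [ff'e f0 f'0]]]] := semisimple_split ssH ee e0 nem.
have lt g g' : g * g = g -> g' * g' = g' -> g' * g = 0 -> g + g' = e -> g' != 0 ->
    g * g' = 0 -> (\dim (limg (amulr g)) < n)%N.
  move=> gg g'g' g'g gg'e g'0 gg'; apply: leq_trans dime.
  rewrite ltn_neqAle (_ : (_ <= _)%N); last first.
    apply/dimvS/subvP=> x /(limg_amulrP _ gg) xg; apply/(limg_amulrP _ ee).
    by rewrite -xg -mulrA -gg'e mulrDr gg gg' addr0.
  rewrite andbT; apply: contra g'0 => /eqP eqd.
  have/eqP : limg (amulr g) == limg (amulr e).
    rewrite eqEdim eqd leqnn andbT; apply/subvP=> x /(limg_amulrP _ gg) xg.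
    by apply/(limg_amulrP _ ee); rewrite -xg -mulrA -gg'e mulrDr gg gg' addr0.
  (* The inclusion of [H g] in [H e] is strict: [g'] lies in [H e], but [g' * g = 0] keeps it out of
     [H g]. *)
  move/vspaceP/(_ g'); have -> : g' \in limg (amulr e).
    by apply/(limg_amulrP _ ee); rewrite -gg'e mulrDr g'g add0r.
  by move/(limg_amulrP _ gg) => <-; rewrite g'g.
have [es [ues mes oes ies ses]] := IHn f (lt f f' ff f'f' f'f ff'e f'0 ff') ff.
have [es' [ues' mes' oes' ies' ses']] :=
  IHn f' (lt f' f f'f' ff ff' (etrans (addrC _ _) ff'e) f0 f'f) f'f'.
have cross x y : x \in es -> y \in es' -> x * y = 0 /\ y * x = 0.
  move=> /ies[fx xf] /ies'[fy yf].
  split; first by rewrite -xf -fy mulrA -[x * f * f']mulrA ff' mulr0 mul0r.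
  by rewrite -yf -fx mulrA -[y * f' * f]mulrA f'f mulr0 mul0r.
exists (es ++ es'); split.
- rewrite cat_uniq ues ues' andbT; apply/hasPn=> x xes'; apply/negP=> xes.
  have [xx _] := cross x x xes xes'; have [xx1 /eqP[]] := mes x xes.
  by rewrite -xx1 xx.
- by move=> x; rewrite mem_cat => /orP[/mes|/mes'].
- move=> x y; rewrite !mem_cat => /orP[] xs /orP[] ys xy; first exact: oes.
  + by case: (cross x y).
  + by case: (cross y x).
  + exact: oes'.
- rewrite -ff'e => x; rewrite mem_cat => /orP[] xs.
    have [fx xf] := ies x xs; split.
      by rewrite -fx mulrA mulrDl ff f'f addr0.
    by rewrite -xf -mulrA mulrDr ff ff' addr0.
  have [fx xf] := ies' x xs; split.
    by rewrite -fx mulrA mulrDl f'f' ff' add0r.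
  by rewrite -xf -mulrA mulrDr f'f' f'f add0r.
by rewrite big_cat /= ses ses'.
Qed.

End Decomposition.

(** * Counting the minimal left ideals of each dimension *)

Section IdempotentSystem.
Variables (k : closedFieldType) (H : falgType k) (I : finType) (e : I -> H).
Hypothesis e_min : forall i, min_idem (e i).
Hypothesis e_orth : forall i j, i != j -> e i * e j = 0.
Hypothesis e_sum : \sum_i e i = 1.

Let ee i : e i * e i = e i. Proof. by have [] := e_min i. Qed.
Let d i := \dim (limg (amulr (e i))).
Let r i j := peirce (e i) (e j) != 0%VS.

(** [H] is the direct sum of the [H e_i]: multiplying a relation on the right by [e i] isolates its
    i-th term. *)
Lemma dim_sum_idem : \dim {:H} = (\sum_i d i)%N.
Proof.
have -> : fullv = (\sum_i limg (amulr (e i)))%VS.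
  apply/eqP; rewrite eqEsubv subvf andbT; apply/subvP=> x _.
  rewrite -[x]mulr1 -e_sum mulr_sumr; apply: memv_suml => i _.
  by apply: (subvP (sumv_sup i (erefl _) (subvv _)));
    apply/limg_amulrP; rewrite // -mulrA ee.
apply/directvP/directv_sum_independent=> us Wus us0 i _.
have usi j : us j * e i = if j == i then us i else 0.
  have /(limg_amulrP _ (ee j)) usj := Wus j isT.
  have [<-//|ji] := eqVneq; by rewrite -usj -mulrA e_orth // mulr0.
have := congr1 ( *%R^~ (e i)) us0; rewrite mul0r mulr_suml => <-.
by rewrite (eq_bigr _ (fun j _ => usi j)) -big_mkcond big_pred1_eq.
Qed.

(* H e_i is the direct sum of the e_j H e_i, each of dimension 0 or 1. *)
Lemma dim_left_ideal_card i : d i = #|[set j | r j i]|.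
Proof.
rewrite -sum1dep_card big_mkcond /=.
under eq_bigr => j _.
  rewrite -[if _ then _ else _]/(nat_of_bool (r j i)) -dim_peirce //.
  over.
rewrite /d; have -> : limg (amulr (e i)) = (\sum_j peirce (e j) (e i))%VS.
  apply/eqP; rewrite eqEsubv; apply/andP; split; apply/subvP=> x.
    move=> /(limg_amulrP _ (ee i)) xe.
    rewrite -xe -[x]mul1r -e_sum !mulr_suml; apply: memv_suml => j _.
    apply: (subvP (sumv_sup j (erefl _) (subvv _))); apply/peirceP; rewrite //.
    by rewrite !mulrA ee -!mulrA ee.
  apply/subvP/subv_sumP=> j _; apply/subvP=> y /(peirceP _ (ee j) (ee i))[_ ye].
  exact/(limg_amulrP _ (ee i)).
apply/directvP/directv_sum_independent=> us Wus us0 l _.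
have usi j : e l * us j = if j == l then us l else 0.
  have /(peirceP _ (ee j) (ee i))[usj _] := Wus j isT.
  have [<-//|jl] := eqVneq; by rewrite -usj mulrA e_orth ?mul0r // eq_sym.
have := congr1 ( *%R (e l)) us0; rewrite mulr0 mulr_sumr => <-.
by rewrite (eq_bigr _ (fun j _ => usi j)) -big_mkcond big_pred1_eq.
Qed.

(** An irreducible representation occurs in the regular one as often as its dimension: the
    isomorphism class of [i] has [d i] elements, so the indices with [d i = m] fall into classes of
    size [m]. *)
Lemma dvdn_card_dim_left_ideal m : (m %| #|[set i | d i == m]|)%N.
Proof.
set D := [set i | _].
have r_equiv : {in D & &, equivalence_rel r}.
  move=> i j l _ _ _; split; first exact: peirce_refl.
  move=> rij; apply/idP/idP; last exact: peirce_trans rij.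
  by apply: peirce_trans; rewrite // peirce_sym.
have := equivalence_partitionP r_equiv.
set P := equivalence_partition _ _ => partP.
rewrite (@card_uniform_partition _ m P) ?dvdn_mull //.
move=> A /imsetP[i]; rewrite inE => /eqP dim ->.
rewrite -dim dim_left_ideal_card; apply: eq_card => j; rewrite !inE.
rewrite /r peirce_sym // andb_idl // => rji.
by rewrite -dim /d (dim_limg_amulr_peirce _ _ rji).
Qed.

(** The [d i] left ideals isomorphic to [H e_i] contribute [d i] each to the dimension. *)
Lemma dim_left_ideal_sqr i : (d i ^ 2 <= \dim {:H})%N.
Proof.
rewrite dim_sum_idem (bigID (mem [set j | r j i])) /= -mulnn.
apply: leq_trans (leq_addr _ _).
rewrite {1}[d i]dim_left_ideal_card -sum_nat_const.
apply: leq_sum => j; rewrite inE => rji.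
by rewrite /d (dim_limg_amulr_peirce _ _ rji).
Qed.

End IdempotentSystem.

(** * Minimal left ideals as irreducible representations *)

Section LeftIdealRepresentation.
Variables (k : fieldType) (H : falgType k) (e : H).
Hypothesis e_min : min_idem e.

Let ee : e * e = e. Proof. by case: e_min. Qed.

Local Notation L := (subvs_of (limg (amulr e))).

(** [H e] is stable under left multiplication, so [vsproj] merely returns the product to the
    subtype. *)
Definition left_ideal_act (a : H) (v : L) : L := vsproj _ (a * vsval v).

Fact left_ideal_act_linear a : linear (left_ideal_act a).
Proof.
by move=> c u v; rewrite /left_ideal_act linearP mulrDr -scalerAr linearP.
Qed.
HB.instance Definition _ a :=
  GRing.isLinear.Build k L L _ (left_ideal_act a) (left_ideal_act_linear a).

Definition left_ideal_rep (a : H) : 'End(L) := linfun (left_ideal_act a).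

Lemma vsval_left_ideal_rep a v : vsval (left_ideal_rep a v) = a * vsval v.
Proof.
rewrite lfunE /= vsprojK //; apply/limg_amulrP => //.
by rewrite -mulrA; have /limg_amulrP-> := subvsP v.
Qed.

Lemma left_ideal_rep_representation : is_representation left_ideal_rep.
Proof.
split=> [c a b||a b]; apply/lfunP=> v; apply: subvs_inj.
- rewrite add_lfunE scale_lfunE linearP /= !vsval_left_ideal_rep.
  by rewrite mulrDl -scalerAl.
- by rewrite vsval_left_ideal_rep mul1r lfunE.
- by rewrite comp_lfunE !vsval_left_ideal_rep mulrA.
Qed.

(** A nonzero [w] in [W] satisfies [y * w = e] for some [y], so [v = v * e = (v * y) * w] for all
    [v] in [H e]. *)
Lemma left_ideal_rep_irreducible : irreducible left_ideal_rep.
Proof.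
have [_ e0 emin] := e_min; split.
  rewrite -dimv_eq0 dimvf /= dimv_eq0; apply: contraNneq e0 => L0.
  by rewrite -memv0 -L0; apply/limg_amulrP.
move=> W sW; have [->|W0] := eqVneq W 0%VS; [by left | right].
have w0 : vsval (vpick W) != 0.
  by rewrite -[0]/(vsval (0 : L)) (inj_eq subvs_inj) vpick0.
have /limg_amulrP we := subvsP (vpick W).
have [y yw] := emin _ (we ee) w0.
apply/eqP; rewrite eqEsubv subvf; apply/subvP=> v _.
have -> : v = left_ideal_rep (vsval v * y) (vpick W).
  apply: subvs_inj; rewrite vsval_left_ideal_rep -mulrA yw.
  by have /limg_amulrP-> := subvsP v.
exact: (subvP (sW (vsval v * y)) _ (memv_img _ (memv_pick W))).
Qed.

Lemma dim_left_ideal_rep : \dim {:L} = \dim (limg (amulr e)).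
Proof. by rewrite dimvf. Qed.

End LeftIdealRepresentation.

(** * Algebra maps to the base field and one-dimensional left ideals *)

Section AlgebraMaps.
Variables (k : fieldType) (H : falgType k).

Definition algebra_char (chi : H -> k) : Prop :=
  [/\ forall a x y, chi (a *: x + y) = a * chi x + chi y, chi 1 = 1 &
      forall x y, chi (x * y) = chi x * chi y].

(** [H e] is the line [k e], on which [h] acts by a scalar [chi h], unique because [e != 0]. *)
Lemma algebra_char_of_idem (e : H) : e * e = e -> \dim (limg (amulr e)) = 1%N ->
  exists2 chi, algebra_char chi & forall h, h * e = chi h *: e.
Proof.
move=> ee dime.
have e0 : e != 0.
  apply: contra_eq_neq dime => ->; rewrite [amulr 0]linear0.
  rewrite (_ : limg _ = 0%VS) ?dimv0 //; apply/eqP; rewrite -lkerE.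
  by apply/subvP=> x _; rewrite memv_ker zero_lfunE.
have line : limg (amulr e) = <[e]>%VS.
  apply/eqP; rewrite eq_sym eqEdim dim_vline e0 dime leqnn andbT -memvE.
  exact/limg_amulrP.
have ex h : exists a, h * e == a *: e.
  have: h * e \in <[e]>%VS by rewrite -line; apply/limg_amulrP; rewrite // -mulrA ee.
  by case/vlineP=> a ->; exists a.
pose chi h := xchoose (ex h).
have chiE h : h * e = chi h *: e by apply/eqP/(xchooseP (ex h)).
have inj a b : a *: e = b *: e -> a = b.
  move/eqP; rewrite -subr_eq0 -scalerBl scaler_eq0 (negPf e0) orbF subr_eq0.
  by move/eqP.
exists chi => //; split=> [a x y||x y]; apply: inj; rewrite -chiE.
- by rewrite mulrDl -scalerAl !chiE scalerDl scalerA.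
- by rewrite mul1r scale1r.
- by rewrite -mulrA chiE -scalerAr chiE scalerA mulrC.
Qed.

Lemma algebra_char_sum chi (I : Type) (s : seq I) (F : I -> H) : algebra_char chi ->
  chi (\sum_(i <- s) F i) = \sum_(i <- s) chi (F i).
Proof.
case=> chiL _ _; have chi0 : chi 0 = 0.
  by have := chiL (-1) 0 0; rewrite scaleN1r oppr0 addr0 mulN1r addNr.
have chiD x y : chi (x + y) = chi x + chi y.
  by have := chiL 1 x y; rewrite scale1r mul1r.
by elim: s => [|i s IH]; rewrite ?big_nil // !big_cons chiD IH.
Qed.

(** Here [chi e = 1], so by minimality [chi] has no nonzero zero in [H e]; but it vanishes at
    [h * e - chi h *: e]. *)
Lemma algebra_char_idem chi (e : H) : algebra_char chi -> min_idem e ->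
  chi e != 0 -> \dim (limg (amulr e)) = 1%N /\ forall h, h * e = chi h *: e.
Proof.
move=> [chiL chi1 chiM] [ee e0 emin] chie0.
have chie : chi e = 1.
  by apply: (mulfI chie0); rewrite mulr1 -chiM ee.
have chi0 : chi 0 = 0.
  by have := chiL (-1) 0 0; rewrite scaleN1r oppr0 addr0 mulN1r addNr.
have ker x : x * e = x -> chi x = 0 -> x = 0.
  move=> xe chix; apply/eqP/negPn/negP=> x0; have [y yx] := emin x xe x0.
  by move/eqP: chie; rewrite -yx chiM chix mulr0 eq_sym oner_eq0.
have he h : h * e = chi h *: e.
  apply/eqP; rewrite -subr_eq0; apply/eqP/ker.
    by rewrite mulrBl -mulrA -scalerAl ee.
  by rewrite addrC -scaleNr chiL chiM chie mulr1 mulNr mulr1 addNr.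
split=> //; suff -> : limg (amulr e) = <[e]>%VS by rewrite dim_vline e0.
apply/eqP; rewrite eqEsubv -memvE; apply/andP; split.
  by apply/subvP=> _ /memv_imgP[h _ ->]; rewrite lfunE /= he memvZ ?memv_line.
exact/limg_amulrP.
Qed.

End AlgebraMaps.

(** * Grouplike elements *)

Section Grouplike.
Variables (k : fieldType) (A : hopfAlgType k).
Local Notation D := (hopf_dual A).
Implicit Types (f : D) (a g : A).

Definition grouplike a : Prop := comul a = a ⊗ a /\ counit a = 1.

Lemma dual_sep a b : (forall f, f a = f b) -> a = b.
Proof.
move=> ab; rewrite (coord_vbasis (memvf a)) (coord_vbasis (memvf b)).
apply: eq_bigr => i _; congr (_ *: _).
by have := ab (linfun (@hdual_coord k A i)); rewrite !lfunE.
Qed.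

(** Pairs of coordinate forms read off the matrix entries of a tensor. *)
Lemma dual_tensor_sep (s t : tensor A A) :
  (forall f f', tlift (fun x y => f x * f' y : k^o) s =
                tlift (fun x y => f x * f' y : k^o) t) -> s = t.
Proof.
have E (u : tensor A A) i j : tlift (fun x y =>
    linfun (@hdual_coord k A i) x * linfun (@hdual_coord k A j) y : k^o) u = u i j.
  pose pr (u : tensor A A) : k^o := u i j.
  apply: (@tens_ext _ _ _ _ _ pr) => [c x y|c x y|x y].
  - by rewrite linearP.
  - by rewrite /pr !mxE.
  by rewrite tliftE /pr ?mxE ?lfunE //; apply: hdual_mul_bil.
by move=> st; apply/matrixP=> i j; rewrite -!E st.
Qed.

(** By finite-dimensional biduality [chi] is evaluation at some [g]. The product of the dual is the
    transpose of [comul], so multiplicativity of [chi] says that [comul g] and [g ⊗ g] agree under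
    every [f ⊗ f']. *)
Lemma algebra_char_grouplike (chi : D -> k) : algebra_char chi ->
  exists2 g, grouplike g & forall f, chi f = f g.
Proof.
move=> chi_char; have [chiL chi1 chiM] := chi_char.
pose g := \sum_i chi (linfun (@hdual_coord k A i)) *: (vbasis {:A})`_i.
have chiE f : chi f = f g.
  have chiZ c x : chi (c *: x) = c * chi x.
    have := chiL c x 0; rewrite addr0 => ->.
    by have := chiL (-1) 0 0; rewrite scaleN1r oppr0 addr0 mulN1r addNr => ->;
      rewrite addr0.
  rewrite {1}[f]hdual_coordK algebra_char_sum // /g linear_sum.
  by apply: eq_bigr => i _; rewrite chiZ linearZ mulrC.
exists g => //; split; last by rewrite -dual1 -chiE.
apply: dual_tensor_sep => f f'; rewrite -dualM -chiE chiM !chiE tliftE //.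
exact: hdual_mul_bil.
Qed.

Lemma grouplike_algebra_char g : grouplike g -> algebra_char (fun f : D => f g).
Proof.
case=> cg eg; split=> [a x y||x y]; first by rewrite add_lfunE scale_lfunE.
  by rewrite dual1.
by rewrite dualM cg tliftE //; apply: hdual_mul_bil.
Qed.

Lemma grouplike1 : grouplike 1.
Proof. by split; [exact: comul1 | exact: counit1]. Qed.

Lemma grouplikeM a b : grouplike a -> grouplike b -> grouplike (a * b).
Proof.
move=> [ca ea] [cb eb]; split; first by rewrite comulM ca cb tmulE.
by rewrite counitM ea eb mulr1.
Qed.

Lemma grouplike_antipode a : grouplike a -> antipode a * a = 1.
Proof.
move=> [ca ea]; have := antipodel a; rewrite ca ea scale1r tliftE //.
have bm := mul_bilin A; split=> [v|v] c x y; first by rewrite (bilinPr bm).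
by rewrite linearP (bilinPl bm).
Qed.

End Grouplike.

(* The grouplikes of A are the algebra maps D -> k, which correspond to the
   one-dimensional left ideals D e_i.  The F i are the e_i themselves, seen as
   functionals on A; g i is a junk value unless d i = 1. *)
Lemma grouplike_enum (k : closedFieldType) (A : hopfAlgType k)
    (D := hopf_dual A) : semisimple D ->
  exists (s : nat) (d : 'I_s -> nat) (g : 'I_s -> A) (F : 'I_s -> D),
  [/\ \dim {:A} = (\sum_i d i)%N,
      forall m, (m %| #|[set i | d i == m]|)%N,
      forall i, (d i ^ 2 <= \dim {:A})%N /\
        exists (V : vectType k) (rho : D -> 'End(V)),
        [/\ is_representation rho, irreducible rho & \dim {:V} = d i],
      (forall i, d i = 1%N -> grouplike (g i)) /\
      (forall a, grouplike a -> exists2 i, d i = 1%N & a = g i) &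
      forall i j, d i = 1%N -> d j = 1%N -> F i (g j) = (i == j)%:R].
Proof.
move=> ssD.
have [es [ues mes oes _ ses]] := semisimple_min_idems ssD (mulr1 (1 : D)).
pose s := size es; pose e (i : 'I_s) : D := es`_i.
have emin i : min_idem (e i) by apply: mes; rewrite mem_nth.
have eorth i j : i != j -> e i * e j = 0.
  by move=> ij; apply: oes; rewrite ?mem_nth // nth_uniq.
have esum : \sum_i e i = 1 by rewrite -ses (big_nth 0) big_mkord.
pose d (i : 'I_s) : nat := \dim (limg (amulr (e i))).
have exg i : exists g : A, d i = 1%N ->
    grouplike g /\ forall h : D, h * e i = (h g : k) *: e i.
  have [di|di] := eqVneq (d i) 1%N; last by exists 0 => di1; rewrite di1 in di.
  have [ee _ _] := emin i; have [chi chic chiE] := algebra_char_of_idem ee di.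
  have [g gg gE] := algebra_char_grouplike chic.
  by exists g => _; split=> // h; rewrite chiE gE.
have [g gP] : exists g : 'I_s -> A, forall i, d i = 1%N ->
    grouplike (g i) /\ forall h : D, h * e i = (h (g i) : k) *: e i.
  exact: fin_all_exists exg.
exists s, d, g, e.
have dimD : \dim {:D} = \dim {:A}.
  by rewrite !dimvf; exact: muln1.
have inj i (a b : k) : a *: e i = b *: e i -> a = b.
  move/eqP; have [_ e0 _] := emin i.
  by rewrite -subr_eq0 -scalerBl scaler_eq0 (negPf e0) orbF subr_eq0 => /eqP.
(* This is [h * e j = h (g j) *: e j] for [h = e i], combined with orthogonality. *)
have Fg i j : d j = 1%N -> e i (g j) = (i == j)%:R.
  move=> dj; apply: (inj j); rewrite -(gP j dj).2.
  have [->|ij] := eqVneq; last by rewrite scale0r eorth.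
  by rewrite scale1r; have [] := emin j.
split.
- by rewrite -dimD (dim_sum_idem emin eorth esum).
- exact: dvdn_card_dim_left_ideal.
- move=> i; split; first by rewrite -dimD; apply: dim_left_ideal_sqr.
  exists (subvs_of (limg (amulr (e i)))), (left_ideal_rep (e i)).
  rewrite dim_left_ideal_rep; split=> //.
    by apply: left_ideal_rep_representation.
  by apply: left_ideal_rep_irreducible.
- split=> [i di|a ga]; first by case: (gP i di).
  have chia := grouplike_algebra_char ga.
  (* The [e i] sum to the unit of the dual, whose value at [a] is 1. *)
  have [i ei0] : exists i, e i a != 0.
    have [i ?|ea0] := pickP (fun i => e i a != 0); first by exists i.
    have /eqP := algebra_char_sum (index_enum _) e chia; rewrite esum.
    rewrite big1 => [|i _]; last by apply/eqP/negbFE/ea0.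
    by have [_ -> _] := chia; rewrite oner_eq0.
  have [di he] := algebra_char_idem chia (emin i) ei0; exists i => //.
  (* Both [f a] and [f (g i)] are the scalar by which [f] acts on the line spanned by [e i]. *)
  by apply: dual_sep => f; apply: (inj i); rewrite -he -(gP i di).2.
- by move=> i j _; apply: Fg.
Qed.


(** * Traces of left multiplications *)

Lemma natr_inj_pchar0 (R : idomainType) : [pchar R] =i pred0 ->
  injective (fun n : nat => n%:R : R).
Proof.
move=> /pcharf0P char0 m n /=; wlog le_mn : m n / (m <= n)%N.
  by move=> IH; have [/IH//|/ltnW/IH mn /esym/mn] := leqP m n.
move=> /eqP; rewrite eq_sym -subr_eq0 -natrB // char0 subn_eq0 => le_nm.
by apply/eqP; rewrite eqn_leq le_mn.
Qed.

(** In a full-rank factorization [M = C R], the relation [C (R C) R = C R] cancels to [R C = 1], an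
    identity matrix of size the rank. *)
Lemma mxtrace_idem (k : fieldType) n (M : 'M[k]_n) : M *m M = M -> \tr M = (\rank M)%:R.
Proof.
move=> MM; rewrite -[in LHS](mulmx_base M) mxtrace_mulC.
suff -> : row_base M *m col_base M = 1%:M by rewrite mxtrace1.
apply: (row_free_inj (row_base_free M)).
apply: (can_inj (@trmxK _ _ _)); apply: (row_free_inj (A := (col_base M)^T)).
  by rewrite /row_free mxrank_tr -/(row_full _) col_base_full.
rewrite -!trmx_mul; congr (_^T).
by rewrite mul1mx -mulmxA mulmx_base mulmxA mulmx_base.
Qed.

Section Trace.
Variable k : fieldType.

(** Images of basis vectors are rows, so composing maps multiplies their matrices in the opposite
    order. *)
Definition lfun_mx (V : vectType k) (f : V -> V) : 'M[k]_(\dim {:V}) :=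
  \matrix_(i, j) coord (vbasis {:V}) j (f (vbasis {:V})`_i).

Definition tensor_trace (V W : vectType k) (F : tensor V W -> tensor V W) : k :=
  \sum_i \sum_j F (delta_mx i j) i j.

Lemma lfun_mxE (V : vectType k) (f : V -> V) (i : 'I_(\dim {:V})) :
  f (vbasis {:V})`_i = \sum_j lfun_mx f i j *: (vbasis {:V})`_j.
Proof.
by rewrite {1}(coord_vbasis (memvf (f _))); apply: eq_bigr => j _; rewrite mxE.
Qed.

Lemma lfun_mx_comp (V : vectType k) (f g : V -> V) : linear g ->
  lfun_mx (g \o f) = lfun_mx f *m lfun_mx g.
Proof.
move=> gL; pose g' : {linear V -> V} := HB.pack g (GRing.isLinear.Build k _ _ _ g gL).
apply/matrixP=> i j; rewrite !mxE /= (lfun_mxE f).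
rewrite -[g]/(g' : _ -> _) linear_sum linear_sum.
by apply: eq_bigr => l _; rewrite !linearZ !mxE.
Qed.

Lemma lfun_mx_inj (V : vectType k) (f g : V -> V) : linear f -> linear g ->
  lfun_mx f = lfun_mx g -> f =1 g.
Proof.
move=> fL gL fg v.
pose g' : {linear V -> V} := HB.pack g (GRing.isLinear.Build k _ _ _ g gL).
pose f' : {linear V -> V} := HB.pack f (GRing.isLinear.Build k _ _ _ f fL).
rewrite (coord_vbasis (memvf v)) -[f]/(f' : _ -> _) -[g]/(g' : _ -> _) !linear_sum.
by apply: eq_bigr => i _; rewrite !linearZ /= !lfun_mxE fg.
Qed.

Lemma lfun_mx_id (V : vectType k) : lfun_mx (@id V) = 1%:M.
Proof.
by apply/matrixP=> i j; rewrite !mxE coord_free ?(basis_free (vbasisP _)) // eq_sym.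
Qed.

(** Cyclicity of the trace, written in the basis of the [delta_mx i j]; it serves to compare
    conjugate endomorphisms. *)
Lemma tensor_traceC (V W : vectType k) (F G : tensor V W -> tensor V W) :
  linear F -> linear G -> tensor_trace (F \o G) = tensor_trace (G \o F).
Proof.
move=> FL GL.
have E (P Q : tensor V W -> tensor V W) : linear P ->
    tensor_trace (P \o Q) =
    \sum_i \sum_j \sum_i' \sum_j' Q (delta_mx i j) i' j' * P (delta_mx i' j') i j.
  move=> PL; pose P' : {linear _ -> _} := HB.pack P (GRing.isLinear.Build k _ _ _ P PL).
  apply: eq_bigr => i _; apply: eq_bigr => j _.
  rewrite /= {1}[Q _]matrix_sum_delta -[P]/(P' : _ -> _) linear_sum summxE.
  apply: eq_bigr => i' _; rewrite linear_sum summxE.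
  by apply: eq_bigr => j' _; rewrite linearZ mxE.
rewrite !E //.
under eq_bigr => i _ do rewrite exchange_big.
rewrite exchange_big; apply: eq_bigr => i _ /=.
under eq_bigr => i' _ do rewrite exchange_big.
rewrite exchange_big; apply: eq_bigr => j _ /=.
by apply: eq_bigr => i' _; apply: eq_bigr => j' _; rewrite mulrC.
Qed.

Lemma eq_tensor_trace (V W : vectType k) (F G : tensor V W -> tensor V W) :
  F =1 G -> tensor_trace F = tensor_trace G.
Proof. by move=> FG; apply: eq_bigr => i _; apply: eq_bigr => j _; rewrite FG. Qed.

Lemma tensor_trace_tmap (V W : vectType k) (f : V -> V) (g : W -> W) :
  linear f -> linear g -> tensor_trace (tmap f g) = \tr (lfun_mx f) * \tr (lfun_mx g).
Proof.
move=> fL gL; rewrite /mxtrace mulr_suml; apply: eq_bigr => i _.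
rewrite mulr_sumr; apply: eq_bigr => j _.
by rewrite -tens_basis tmapE // !mxE.
Qed.

Lemma bilin_tens (V W V' W' : vectType k) (f : V -> V') (g : W -> W') :
  linear f -> linear g -> bilin (fun x y => f x ⊗ g y).
Proof.
move=> fL gL; split=> [v|w] a x y.
  by rewrite gL (bilinPr (tens_bilin _ _)).
by rewrite fL (bilinPl (tens_bilin _ _)).
Qed.

Lemma comp_linear (U V W : vectType k) (F : V -> W) (G : U -> V) :
  linear F -> linear G -> linear (fun u => F (G u)).
Proof. by move=> FL GL c u v; rewrite GL FL. Qed.

Lemma tlift_is_linear (V W U : vectType k) (b : V -> W -> U) : linear (tlift b).
Proof. exact: linearP. Qed.

Lemma tmap_is_linear (V W V' W' : vectType k) (f : V -> V') (g : W -> W') :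
  linear (tmap f g).
Proof. exact: tlift_is_linear. Qed.

End Trace.

(** * The Galois map and the traces of grouplikes *)

Section GaloisMap.
Variables (k : fieldType) (A : hopfAlgType k).
Implicit Types (a b x y g : A) (f h : 'End(A)).

Let bt := tens_bilin A A.
Let bm := mul_bilin A.

Lemma mull_linear b : linear (fun x : A => b * x).
Proof. by move=> c x y; rewrite (bilinPr bm). Qed.

(* a ⊗ b |-> a_(1) ⊗ f(a_(2)) b.  For f the identity it conjugates L_g ⊗ id to
   L_g ⊗ L_g when g is grouplike; taking f the antipode gives its inverse. *)
Definition galois_map f : tensor A A -> tensor A A :=
  tlift (fun a b => tlift (fun x y => x ⊗ (f y * b)) (comul a)).

Lemma galois_mapE f a b :
  galois_map f (a ⊗ b) = tlift (fun x y => x ⊗ (f y * b)) (comul a).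
Proof.
apply: tliftE; split=> [v|v] c x y; last by rewrite linearP linearP.
rewrite -tlift_comb; apply: eq_tlift => u w.
by rewrite (bilinPr bm) (bilinPr bt).
Qed.

(** The composite sends [a ⊗ b] to [a_(1) ⊗ f(a_(2)) h(a_(3)) b], which the hypothesis and the
    counit law reduce to [a ⊗ b]. *)
Lemma galois_mapK f h :
  (forall a, tlift (fun x y => f x * h y) (comul a) = (counit a : k)%:A) ->
  cancel (galois_map h) (galois_map f).
Proof.
move=> fh; apply: tens_ext => [||a b].
- by apply: comp_linear; apply: tlift_is_linear.
- by [].
have bfh : bilin (fun x y => f x * h y).
  by split=> [v|v] c x y; rewrite linearP ?(bilinPr bm) ?(bilinPl bm).
pose m := tlift (fun x y => f x * h y).
(* [Phi] sends [x ⊗ (u ⊗ v)] to [x ⊗ f(u) h(v) b], a shape to which coassociativity applies. *)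
pose Phi := tlift (fun x t => x ⊗ (m t * b)).
have mL : linear (fun t => m t * b).
  by move=> c s t; rewrite /m linearP (bilinPl bm).
have PhiE x t : Phi (x ⊗ t) = x ⊗ (m t * b).
  by rewrite /Phi tliftE //; apply: bilin_tens.
have PhiL : linear Phi by apply: tlift_is_linear.
transitivity (Phi (tmap idfun comul (comul a))).
  rewrite galois_mapE -comulA.
  move: (comul a); apply: tens_ext => [||x y].
  - by apply: comp_linear; apply: tlift_is_linear.
  - apply: comp_linear => //; apply: comp_linear; first exact: tlift_is_linear.
    exact: tmap_is_linear.
  have hL : linear (fun y => h y * b).
    by move=> c u v; rewrite linearP (bilinPl bm).
  rewrite tliftE; last exact: bilin_tens.
  rewrite galois_mapE tmapE //; last exact: linear_id_lfun.
  move: (comul x); apply: tens_ext => [||u v].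
  - exact: tlift_is_linear.
  - move=> c s t /=; rewrite (bilinPl (tens_bilin _ _)).
    by rewrite /tassoc linearP PhiL.
  rewrite tassocE PhiE /m (tliftE bfh).
  rewrite (tliftE (b := fun x y0 => x ⊗ (f y0 * (h y * b)))).
    by rewrite mulrA.
  by apply: bilin_tens => // c s t; rewrite linearP (bilinPl bm).
have E x y : Phi (tmap idfun comul (x ⊗ y)) = ((counit y : k) *: x) ⊗ b.
  rewrite tmapE ?PhiE; [|by []|exact: linear_id_lfun].
  rewrite /m fh -scalerAl mul1r.
  have := bilinPr bt x (counit y : k) b 0; rewrite addr0 => ->.
  have := bilinPl bt b (counit y : k) x 0; rewrite addr0 => ->.
  by rewrite (bilin0r bt) (bilin0l bt).
transitivity (tlift (fun x y => (counit y : k) *: x) (comul a) ⊗ b); last first.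
  by rewrite counitr.
move: (comul a); apply: tens_ext => [||x y].
- by apply: comp_linear => //; apply: tmap_is_linear.
- by move=> c s t; rewrite linearP (bilinPl bt).
rewrite E tliftE //; split=> [v|v] c s t; last by rewrite scalerDr !scalerA mulrC.
by rewrite linearP scalerDl scalerA.
Qed.

Definition left_trace a : k := \tr (lfun_mx (fun x : A => a * x)).

Lemma left_trace_grouplike g : comul g = g ⊗ g ->
  left_trace g * left_trace g = left_trace g * (\dim {:A})%:R.
Proof.
move=> cg; pose L x : A := g * x; have LL : linear L := mull_linear g.
have linG f : linear (galois_map f) := tlift_is_linear _.
have idL : linear (idfun : A -> A) by [].
have GK : cancel (galois_map antipode) (galois_map \1%VF).
  apply: galois_mapK => a; rewrite -antipoder; apply: eq_tlift => x y.
  by rewrite id_lfunE.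
have GK' : cancel (galois_map \1%VF) (galois_map antipode).
  apply: galois_mapK => a; rewrite -antipodel; apply: eq_tlift => x y.
  by rewrite id_lfunE.
(* Both sides send [a ⊗ b] to [g a_(1) ⊗ g a_(2) b]. *)
have TL : galois_map \1%VF \o @tmap k A A A A L idfun =1 tmap L L \o galois_map \1%VF.
  apply: tens_ext => [||a b].
  - by apply: comp_linear => //; apply: tmap_is_linear.
  - by apply: comp_linear => //; apply: tmap_is_linear.
  rewrite /= tmapE // !galois_mapE comulM cg.
  have bb : bilin (fun x y => x ⊗ (\1%VF y * b) : tensor A A).
    by apply: bilin_tens => // c s t; rewrite linearP (bilinPl bm).
  move: (comul a); apply: tens_ext => [||x y].
  - by apply: comp_linear; [apply: tlift_is_linear | exact: (tmul_bilin A).1].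
  - by apply: comp_linear; [apply: tmap_is_linear | apply: tlift_is_linear].
  by rewrite tmulE !(tliftE bb) !id_lfunE tmapE //= /L mulrA.
have <- : tensor_trace (tmap L L) = left_trace g * left_trace g.
  exact: tensor_trace_tmap.
have <- : tensor_trace (@tmap k A A A A L idfun) = left_trace g * (\dim {:A})%:R.
  by rewrite tensor_trace_tmap // lfun_mx_id mxtrace1.
transitivity (tensor_trace ((tmap L L \o galois_map \1%VF) \o galois_map antipode)).
  by apply: eq_tensor_trace => t /=; rewrite GK.
transitivity (tensor_trace
  (galois_map antipode \o (galois_map \1%VF \o @tmap k A A A A L idfun))).
  rewrite tensor_traceC //; last by apply: comp_linear => //; apply: tmap_is_linear.
  by apply: eq_tensor_trace => t /=; rewrite -[tmap L L _]TL.
by apply: eq_tensor_trace => t /=; rewrite GK'.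
Qed.

Lemma left_traceD c a b : left_trace (c *: a + b) = c * left_trace a + left_trace b.
Proof.
rewrite /left_trace -mxtraceZ -mxtraceD; congr (\tr _); apply/matrixP=> i j.
by rewrite !mxE (bilinPl bm) linearP.
Qed.

Lemma left_trace0 : left_trace 0 = 0.
Proof. by have := left_traceD (-1) 0 0; rewrite scaler0 addr0 mulN1r addNr. Qed.

Lemma left_trace_sum (I : Type) (r : seq I) (F : I -> A) :
  left_trace (\sum_(i <- r) F i) = \sum_(i <- r) left_trace (F i).
Proof.
elim: r => [|i r IH]; first by rewrite !big_nil left_trace0.
by rewrite !big_cons -[F i]scale1r left_traceD IH mul1r scale1r.
Qed.

Lemma left_trace1 : left_trace 1 = (\dim {:A})%:R.
Proof.
rewrite -mxtrace1 -lfun_mx_id; congr (\tr _); apply/matrixP=> i j.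
by rewrite !mxE mul1r.
Qed.

(** The witness is the rank of left multiplication by [a]; full rank makes this idempotent map the
    identity, and its value at 1 is [a]. *)
Lemma left_trace_idem a : a * a = a ->
  exists2 m, left_trace a = m%:R & (m = \dim {:A} -> a = 1).
Proof.
move=> aa; have aL := mull_linear a; set L := fun x : A => a * x in aL.
have MM : lfun_mx L *m lfun_mx L = lfun_mx L.
  rewrite -lfun_mx_comp //; apply/matrixP=> i j.
  by rewrite !mxE /= /L mulrA aa.
exists (\rank (lfun_mx L)); first exact: mxtrace_idem.
move=> rk; have Mfree : row_free (lfun_mx L) by rewrite /row_free rk.
have M1 : lfun_mx L = lfun_mx (@id A).
  by rewrite lfun_mx_id; apply: (row_free_inj Mfree); rewrite mul1mx.
by have := lfun_mx_inj aL (fun _ _ _ => erefl) M1 1; rewrite /L mulr1.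
Qed.

(* The rank m of the idempotent e = (1 + g + ... + g^(r-1)) / r acting on A is
   the mean of the traces of the powers of g, each 0 or n = dim A.  So m r = c n
   with 0 < c <= r, and c = r would force e = 1, hence g = 1. *)
Lemma grouplike_order_dvd g r : [pchar k] =i pred0 -> prime r ->
  comul g = g ⊗ g -> g ^+ r = 1 -> g != 1 -> (r %| \dim {:A})%N.
Proof.
move=> char_k r_pr cg gr g1; have char0 := (pcharf0P _).1 char_k.
have r0 : r%:R != 0 :> k by rewrite char0 -lt0n prime_gt0.
pose n : nat := \dim {:A}.
have cgj j : comul (g ^+ j) = g ^+ j ⊗ g ^+ j.
  by elim: j => [|j IH]; rewrite ?expr0 ?comul1 // exprS comulM cg IH tmulE.
pose S := \sum_(j < r) g ^+ j.
have gS : g * S = S.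
  (* Multiplication by [g] shifts the powers cyclically, the last one becoming [g ^+ r = 1]. *)
  rewrite /S mulr_sumr -(prednK (prime_gt0 r_pr)) big_ord_recr big_ord_recl /=.
  rewrite addrC; congr (_ + _); last by apply: eq_bigr => j _; rewrite -exprS.
  by rewrite -exprS prednK ?prime_gt0 // gr expr0.
have gjS j : g ^+ j * S = S.
  by elim: j => [|j IH]; rewrite ?mul1r // exprSr -mulrA gS.
pose e := (r%:R^-1 : k) *: S.
have ee : e * e = e.
  rewrite /e -scalerAl -scalerAr [in S * S]/S mulr_suml.
  under eq_bigr => j _ do rewrite gjS.
  by rewrite sumr_const card_ord -scaler_nat [X in _ *: X]scalerA mulVf ?scale1r.
pose c (j : nat) : nat := (left_trace (g ^+ j) != 0).
have tj j : left_trace (g ^+ j) = (c j * n)%:R.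
  rewrite /c; have [->//|t0] := eqVneq; rewrite mul1n.
  exact: (mulfI t0 (left_trace_grouplike (cgj j))).
have [m tm m1] := left_trace_idem ee.
have eqn : (m * r = (\sum_(j < r) c j) * n)%N.
  apply: (natr_inj_pchar0 char_k); rewrite natrM -tm /e.
  have := left_traceD r%:R^-1 S 0; rewrite !addr0 => ->.
  rewrite left_trace0 addr0 mulrAC mulVf // mul1r left_trace_sum big_distrl natr_sum.
  by apply: eq_bigr => j _; rewrite tj.
have c0 : c 0 = 1%N by rewrite /c expr0 left_trace1 char0 -lt0n adim_gt0.
have cr : (0 < \sum_(j < r) c j <= r)%N.
  apply/andP; split; first by rewrite (bigD1 (Ordinal (prime_gt0 r_pr))) //= c0.
  rewrite -[X in (_ <= X)%N](card_ord r) -sum1_card leq_sum // => j _.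
  exact: leq_b1.
have : (r %| (\sum_(j < r) c j) * n)%N by rewrite -eqn dvdn_mull.
(* If [r] divides the sum of the [c j], which is positive and at most [r], then the sum is [r], so
   [m = n]. *)
rewrite Euclid_dvdM // => /orP[/dvdn_leq|//].
case/andP: cr => cpos cle /(_ cpos) rle.
have cr : (\sum_(j < r) c j = r)%N by apply/eqP; rewrite eqn_leq cle.
have e1 : e = 1.
  apply: m1; apply/eqP; rewrite -(eqn_pmul2r (prime_gt0 r_pr)) eqn cr mulnC //.
case/eqP: g1; have := congr1 ( *%R g) e1.
by rewrite /e -scalerAr gS -/e e1 mulr1.
Qed.

End GaloisMap.

(** * Group algebras *)

(** Left inverses are only asked for in [R]: they make left multiplications injective, hence
    bijective by finiteness, and this produces inverses inside the image of [phi]. So the antipode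
    of a grouplike need not be shown grouplike first. *)
Lemma finite_submonoid_group (R : pzSemiRingType) n (phi : 'I_n -> R) :
    injective phi -> (exists t, phi t = 1) ->
    (forall a b, exists c, phi c = phi a * phi b) ->
    (forall a, exists y, y * phi a = 1) ->
  exists (gT : finGroupType) (psi : gT -> R), [/\ injective psi,
    psi 1%g = 1, forall x y, psi (x * y)%g = psi x * psi y,
    #|gT| = n & forall x, exists t, psi x = phi t].
Proof.
move=> phi_inj [one phi1] exmul exinv.
have [mul mulE] : exists mul : 'I_n -> 'I_n -> 'I_n,
    forall a b, phi (mul a b) = phi a * phi b.
  suff /fin_all_exists : forall a, exists f : 'I_n -> 'I_n,
    forall b, phi (f b) = phi a * phi b by [].
  by move=> a; exact: fin_all_exists (exmul a).
have mulA : associative mul.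
  by move=> a b c; apply: phi_inj; rewrite !mulE mulrA.
have mul1 : left_id one mul by move=> a; apply: phi_inj; rewrite mulE phi1 mul1r.
have mulr1' : right_id one mul by move=> a; apply: phi_inj; rewrite mulE phi1 mulr1.
have mul_inj a : injective (mul a).
  move=> b c /(congr1 phi); rewrite !mulE => bc; apply: phi_inj.
  have [y ya] := exinv a.
  by rewrite -[phi b]mul1r -[phi c]mul1r -ya -!mulrA bc.
pose inv a := invF (@mul_inj a) one.
have mulV a : mul a (inv a) = one by rewrite /inv f_invF.
(* In a monoid where every element has a right inverse, right inverses are two-sided. *)
have Vmul : left_inverse one inv mul.
  move=> a; rewrite -[RHS](mulV (inv a)); congr (mul _ _).
  by rewrite -[RHS]mul1 -(mulV a) -mulA mulV mulr1'.
pose gT : finGroupType := HB.pack 'I_n (Finite_isGroup.Build 'I_n mulA mul1 Vmul).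
by exists gT, phi; split=> //; [exact: card_ord | move=> x; exists x].
Qed.

Section GroupAlgebraIso.
Variables (k : fieldType) (A : hopfAlgType k) (gT : finGroupType).
Variables (psi : gT -> A) (F : gT -> 'Hom(A, k^o)).
Hypothesis psi1 : psi 1%g = 1.
Hypothesis psiM : forall x y, psi (x * y)%g = psi x * psi y.
Hypothesis psi_grouplike : forall x, grouplike (psi x).
Hypothesis F_dual : forall x y, F x (psi y) = (x == y)%:R.
Hypothesis card_gT : #|gT| = \dim {:A}.

Local Notation kG := (group_algebra k gT).

(** The forms [F x] recover the coordinates of an element of [kG] from its image under the linear
    extension of [psi], which is thus injective, and bijective by dimension. Its inverse is the
    isomorphism, checked on group elements. *)
Lemma group_algebra_iso : hopf_isomorphic A kG.
Proof.
pose h : 'Hom(kG, A) := linfun (glift psi).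
have hE g : h (gelt k g) = psi g by rewrite lfunE /= gliftE.
have Fh x u : F x (h u) = u x.
  rewrite lfunE /= /glift linear_sum (bigD1 x) //= big1 ?addr0 => [|y yx].
    by rewrite linearZ /= F_dual eqxx; apply: mulr1.
  by rewrite linearZ /= F_dual eq_sym (negPf yx); apply: mulr0.
have h_inj : injective h by move=> u v uv; apply/ffunP=> x; rewrite -!Fh uv.
have hker : lker h == 0%VS by apply/lker0P.
have h_full : limg h = fullv.
  apply/eqP; rewrite eqEdim subvf limg_dim_eq ?(eqP hker) ?capv0 //.
  rewrite -card_gT [X in (_ <= X)%N]dimvf -[X in (X <= _)%N]muln1.
  exact: leqnn.
pose f := (h^-1)%VF.
have hK : cancel h f := lker0_lfunK hker.
have fK : cancel f h by move=> a; rewrite limg_lfunVK // h_full memvf.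
have fE g : f (psi g) = gelt k g by rewrite -hE hK.
have hM : forall u v, h (u * v) = h u * h v.
  have bm := mul_bilin kG; have bmA := mul_bilin A.
  move=> u v; move: u; apply: gelt_ext => [c x y|c x y|g].
  - by rewrite (bilinPl bm) linearP.
  - by rewrite linearP (bilinPl bmA).
  move: v; apply: gelt_ext => [c x y|c x y|g'].
  - by rewrite (bilinPr bm) linearP.
  - by rewrite linearP (bilinPr bmA).
  by rewrite geltM !hE psiM.
exists f; split.
- by exists h.
- by rewrite -psi1 fE.
- by move=> a b; rewrite -{1}[a]fK -{1}[b]fK -hM hK.
- move=> a; rewrite -[a]fK; move: (f a) => u; rewrite hK.
  move: u; apply: gelt_ext => [c x y|c x y|g].
  + by rewrite linearP.
  + by rewrite linearP linearP /tmap linearP.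
  rewrite hE (psi_grouplike g).1 tmapE ?fE; try exact: linear_id_lfun.
  exact: galg_comulE.
- move=> a; rewrite -[a]fK; move: (f a) => u; rewrite hK.
  move: u; apply: gelt_ext => [c x y|c x y|g].
  + by rewrite linearP.
  + by rewrite linearP linearP.
  by rewrite hE (psi_grouplike g).2; apply: galg_counitE.
move=> a; rewrite -[a]fK; move: (f a) => u; rewrite hK.
move: u; apply: gelt_ext => [c x y|c x y|g].
- by rewrite linearP.
- by rewrite !linearP.
(* The left inverse [antipode (psi g)] must coincide with the right inverse [psi g^-1]. *)
rewrite hE; have -> : antipode (psi g) = psi g^-1%g.
  by rewrite -[LHS]mulr1 -psi1 -(mulgV g) psiM mulrA grouplike_antipode ?mul1r.
by rewrite fE; apply: galg_antipodeE.
Qed.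

End GroupAlgebraIso.

(** * The counting argument in dimension pq *)

Theorem theorem2p4 (k : closedFieldType) (char_k : [pchar k] =i pred0)
    (p q : nat) (p_prime : prime p) (q_prime : prime q) (lt_pq : (p < q)%N)
    (q_neq1 : q <> 1 %[mod p]) (A : hopfAlgType k) (A_ss : semisimple A)
    (dimA : \dim {:A} = (p * q)%N)
    (dualA_frob : frobenius_type (hopf_dual A)) :
  is_group_algebra A.
Proof.
have [ssD frobD] := dualA_frob.
have [s [d [g [F [dimE d_dvd d_irr [g_gl g_all] F_dual]]]]] := grouplike_enum ssD.
have dimD : \dim {:hopf_dual A} = \dim {:A} by rewrite !dimvf; exact: muln1.
have d_1p i : d i = 1%N \/ d i = p.
  (* From [d i ^ 2 <= p * q < q ^ 2] one gets [d i < q], so [d i] is prime to [q] and divides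
     [p]. *)
  have [d2 [V [rho [rep irr dV]]]] := d_irr i.
  have := frobD V rho rep irr; rewrite dimD dV dimA => d_pq.
  have dq : (d i < q)%N.
    rewrite ltnNge; apply/negP=> qd; have := leq_mul qd qd.
    rewrite mulnn leqNgt => /negP[]; apply: leq_ltn_trans d2 _.
    by rewrite dimA ltn_pmul2r ?prime_gt0.
  have d_p : (d i %| p)%N.
    rewrite -(@Gauss_dvdl _ _ q) // coprime_sym prime_coprime //.
    have d0 : (0 < d i)%N by apply: dvdn_gt0 d_pq; rewrite muln_gt0 !prime_gt0.
    by apply: contraL dq => /(dvdn_leq d0); rewrite -leqNgt.
  by have [_ /(_ _ d_p)/orP[]/eqP] := primeP p_prime; [left | right].
(* [T] indexes the grouplikes of [A], that is, the one-dimensional left ideals of the dual. *)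
pose T : finType := {i : 'I_s | d i == 1%N}.
pose phi (t : T) := g (val t).
have dT (t : T) : d (val t) = 1%N by apply/eqP; exact: (valP t).
have F_phi (t u : T) : F (val t) (phi u) = (t == u)%:R.
  by rewrite F_dual // val_eqE.
have phi_inj : injective phi.
  move=> t u tu; apply/eqP; have := F_phi t t.
  by rewrite eqxx tu F_phi; case: eqP => // _ /eqP; rewrite eq_sym oner_eq0.
have phi_gl t : grouplike (phi t) by apply: g_gl.
have phi_all a : grouplike a -> exists t, phi t = a.
  case/g_all=> i /eqP di ->; by exists (exist _ i di).
have phi_rank t : phi (enum_val (enum_rank t)) = phi t by rewrite enum_rankK.
have [|||| gT [psi [psi_inj psi1 psiM card_gT psi_val]]] :=
    @finite_submonoid_group A #|T| (phi \o enum_val).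
- exact: inj_comp phi_inj enum_val_inj.
- have [t <-] := phi_all _ (grouplike1 A); by exists (enum_rank t); apply: phi_rank.
- move=> a b.
  have [t <-] := phi_all _ (grouplikeM (phi_gl (enum_val a)) (phi_gl (enum_val b))).
  by exists (enum_rank t); apply: phi_rank.
- by move=> a; exists (antipode (phi (enum_val a))); apply: grouplike_antipode.
have psi_phi x : exists t, psi x = phi t.
  by have [i ->] := psi_val x; exists (enum_val i).
have psi_gl x : grouplike (psi x) by have [t ->] := psi_phi x.
have psiX x j : psi (x ^+ j)%g = psi x ^+ j.
  by elim: j => [|j IH]; rewrite ?expg0 ?expr0 ?psi1 // expgS exprS psiM IH.
(* Cauchy's theorem supplies a grouplike of order [r]. *)
have order_dvd r : prime r -> (r %| #|gT|)%N -> (r %| p * q)%N.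
  rewrite -cardsT => r_pr /(Cauchy r_pr)[x _ ox]; rewrite -dimA.
  apply: (grouplike_order_dvd char_k r_pr (psi_gl x).1).
    by rewrite -psiX -ox expg_order psi1.
  rewrite -psi1 (inj_eq psi_inj); apply: contraTneq r_pr => x1.
  by rewrite -ox x1 order1.
(* The indices with [d i = 1] count the grouplikes; the others, [c * p] in number, contribute [p]
   each. *)
have [c dim_pc] : exists c, (p * q = #|gT| + c * p ^ 2)%N.
  have [c cE] := dvdnP (d_dvd p); exists c.
  rewrite -dimA dimE (bigID (fun i => d i == 1%N)) /=; congr (_ + _)%N.
    rewrite card_gT card_sig -sum1_card; apply: eq_big => [i|i /eqP //].
    by rewrite inE.
  rewrite -mulnn mulnA -cE -sum_nat_const; apply: eq_big => [i|i].
    rewrite inE; have [->|->] := d_1p i; last by rewrite eqxx gtn_eqF ?prime_gt1.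
    by rewrite eqxx ltn_eqF ?prime_gt1.
  by have [->|] := d_1p i.
have [m Nm] : exists m, #|gT| = (p * m)%N.
  have : (p %| #|gT|)%N.
    have pc : (p %| c * p ^ 2)%N by rewrite expnS mulnCA dvdn_mulr.
    by rewrite -(dvdn_addl _ pc) -dim_pc dvdn_mulr.
  by case/dvdnP=> m ->; exists m; rewrite mulnC.
have p0 := prime_gt0 p_prime.
have q_eq : (q = m + c * p)%N.
  by apply/eqP; rewrite -(eqn_pmul2l p0) dim_pc Nm mulnDr -mulnn mulnCA mulnA.
have mq : m = q.
  have m0 : (0 < m)%N.
    by have := cardG_gt0 [set: gT]; rewrite cardsT Nm muln_gt0 => /andP[].
  have [m1|m_gt1] := eqVneq m 1%N.
    by case: q_neq1; rewrite q_eq m1 addnC modnMDl.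
  have r_pr : prime (pdiv m) by rewrite pdiv_prime // ltn_neqAle eq_sym m_gt1.
  have r_m : (pdiv m %| m)%N := pdiv_dvd m.
  have := order_dvd _ r_pr; rewrite Nm dvdn_mull // => /(_ isT).
  (* The prime [pdiv m] is [p] or [q]. If [p], then [q = m + c * p] is divisible by [p]; if [q],
     then [q <= m], while [m <= q] by the same equation. *)
  rewrite Euclid_dvdM // !dvdn_prime2 // => /orP[/eqP rp|/eqP rq].
    have : (p %| q)%N by rewrite q_eq dvdn_addl ?dvdn_mull // -rp.
    by rewrite dvdn_prime2 // ltn_eqF.
  apply/eqP; rewrite eqn_leq {1}q_eq leq_addr /=.
  by rewrite -rq dvdn_leq.
have [ix ixE] : exists ix : gT -> T, forall x, psi x = phi (ix x).
  exact: fin_all_exists psi_phi.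
exists gT; apply: (@group_algebra_iso _ _ _ psi (fun x => F (val (ix x)))) => //.
  move=> x y; rewrite ixE F_phi; congr (nat_of_bool _)%:R.
  by apply/eqP/eqP=> [xy|->//]; apply: psi_inj; rewrite !ixE xy.
by rewrite Nm mq dimA.
Qed.
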